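(* Let $\mathcal{C}$ be a class of separable, weakly semiprojective $C^*$-algebras. Then every separable $AA\mathcal{C}$-algebra is already an $A\mathcal{C}$-algebra.
   Context: A morphism between $C^*$-algebras is a $*$-homomorphism (not assumed unital); ideals are closed and two-sided. A $C^*$-algebra $A$ is weakly semiprojective if for every $C^*$-algebra $C$, increasing sequence of ideals $J_1\subseteq J_2\subseteq\cdots$ of $C$, morphism $\sigma\colon A\to C/\overline{\bigcup_k J_k}$, $\varepsilon>0$ and finite $F\subseteq A$, there exist an index $k$ and a morphism $\psi\colon A\to C/J_k$ with $\|\pi_k(\psi(x))-\sigma(x)\|<\varepsilon$ for all $x\in F$, where $\pi_k\colon C/J_k\to C/\overline{\bigcup_k J_k}$ is the quotient morphism. An $A\mathcal{C}$-algebra is a $C^*$-algebra isomorphic to the inductive limit of a sequential inductive system $C_1\to C_2\to\cdots$ of algebras in $\mathcal{C}$ (connecting morphisms not necessarily injective). An $AA\mathcal{C}$-algebra is a $C^*$-algebra isomorphic to the inductive limit of a sequential inductive system of $A\mathcal{C}$-algebras. *)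

(* Defs.v *)
From HB Require Import structures.
From mathcomp Require Import all_boot all_order all_algebra.
From mathcomp Require Import generic_quotient ring_quotient complex.
From mathcomp Require Import boolp classical_sets functions cardinality reals.
From mathcomp Require Import topology normedtype sequences.
From mathcomp Require Import ring lra.

Set Implicit Arguments.
Unset Strict Implicit.
Unset Printing Implicit Defensive.
Import Order.TTheory GRing.Theory Num.Theory.
Import numFieldNormedType.Exports.

Local Open Scope classical_set_scope.
Local Open Scope ring_scope.
Local Open Scope complex_scope.
Local Open Scope quotient_scope.

Declare Scope cstar_scope.
Delimit Scope cstar_scope with CS.
Local Open Scope cstar_scope.

HB.mixin Record isCStarAlgebra (R : realType) A & CompleteNormedModule R[i] A := {
  cmul : A -> A -> A;
  cstar : A -> A;
  cmulA : associative cmul;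
  cmulDl : left_distributive cmul +%R;
  cmulDr : right_distributive cmul +%R;
  cscaleAl : forall (a : R[i]) (x y : A), a *: cmul x y = cmul (a *: x) y;
  cscaleAr : forall (a : R[i]) (x y : A), a *: cmul x y = cmul x (a *: y);
  cstarK : involutive cstar;
  cstarD : {morph cstar : x y / x + y};
  cstarZ : forall (a : R[i]) (x : A), cstar (a *: x) = conjc a *: cstar x;
  cstarM : forall x y : A, cstar (cmul x y) = cmul (cstar y) (cstar x);
  ler_cnormM : forall x y : A, `|cmul x y| <= `|x| * `|y|;
  cnorm_star : forall x : A, `|cmul (cstar x) x| = `|x| ^+ 2;
}.

(* Not necessarily unital. *)
#[short(type="cstarAlgType")]
HB.structure Definition CStarAlgebra (R : realType) :=
  {A of isCStarAlgebra R A & CompleteNormedModule R[i] A}.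

Notation "x ** y" := (cmul x y) (at level 40, left associativity) : cstar_scope.

HB.mixin Record isStarMorphism (R : realType) (A B : cstarAlgType R)
    (f : A -> B) := {
  starmM : {morph f : x y / x ** y};
  starmS : {morph f : x / cstar x};
}.

#[short(type="starMorphism")]
HB.structure Definition StarMorphism (R : realType) (A B : cstarAlgType R) :=
  {f of isStarMorphism R A B f & @GRing.Linear R[i] A B *:%R f}.

Notation "{ 'starmorphism' A -> B }" := (starMorphism A B)
  (at level 0, A at level 98, B at level 99) : type_scope.

Section RealNorm.
Context {R : realType}.

Definition rnorm (V : normedModType R[i]) (x : V) : R := complex.Re `|x|.
Local Notation rn := rnorm.

Section normed.
Context {V : normedModType R[i]}.
Implicit Types x y : V.

Lemma normrE_rnorm x : `|x| = (rn x)%:C.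
Proof. by rewrite /rnorm RRe_real // normr_real. Qed.

Lemma rnorm_ge0 x : 0 <= rn x.
Proof. by rewrite -lecR -normrE_rnorm normr_ge0. Qed.

Lemma rnormD x y : rn (x + y) <= rn x + rn y.
Proof. by rewrite -lecR rmorphD /= -!normrE_rnorm ler_normD. Qed.

Lemma rnormN x : rn (- x) = rn x.
Proof. by rewrite /rnorm normrN. Qed.

Lemma rnormC x y : rn (x - y) = rn (y - x).
Proof. by rewrite /rnorm distrC. Qed.

Lemma rnorm0 : rn (0 : V) = 0.
Proof. by rewrite /rnorm normr0. Qed.

Lemma rnorm_eq0 x : rn x = 0 -> x = 0.
Proof. by move=> x0; apply: (@normr0_eq0 R[i]); rewrite normrE_rnorm x0. Qed.

Lemma rnormZ (a : R[i]) x : rn (a *: x) = complex.Re `|a| * rn x.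
Proof.
rewrite /rnorm normrZ; case: `|a| (normr_real a) `|x| (normr_real x).
move=> a1 a2 /[!complex_real] /eqP -> [x1 x2] /[!complex_real] /eqP ->.
by rewrite /= mul0r subr0.
Qed.

Lemma rnormZr (a : R) x : 0 <= a -> rn (a%:C *: x) = a * rn x.
Proof. by move=> a0; rewrite rnormZ ger0_norm ?ler0c. Qed.

Lemma ler_rnormB z x y : rn (x - y) <= rn (x - z) + rn (z - y).
Proof. by have := rnormD (x - z) (z - y); rewrite addrA subrK. Qed.

Lemma closed_rnorm (U : set V) x : closed U ->
  (forall e : R, 0 < e -> exists2 y, U y & rn (x - y) < e) -> U x.
Proof.
move=> cU H; apply: cU => B /nbhs_ballP[e /= e0 eB].
have eE : e = (complex.Re e)%:C by rewrite RRe_real // gtr0_real.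
have [|y Uy xy] := H (complex.Re e); first by rewrite -ltcR -eE.
exists y; split => //; apply: eB; rewrite -ball_normE /ball_ /=.
by rewrite normrE_rnorm eE ltcR.
Qed.

Lemma closure_rnorm (U : set V) x : closure U x ->
  forall e : R, 0 < e -> exists2 y, U y & rn (x - y) < e.
Proof.
move=> Ux e e0.
have [|y [Uy]] := Ux (ball x e%:C).
  by apply: nbhsx_ballx; rewrite ltcR.
rewrite -ball_normE /ball_ /= normrE_rnorm ltcR => xy; by exists y.
Qed.

Lemma rnorm_closure (U : set V) x :
  (forall e : R, 0 < e -> exists2 y, U y & rn (x - y) < e) -> closure U x.
Proof.
move=> H; apply: closed_rnorm; first exact: closed_closure.
move=> e /H[y Uy ?]; exists y => //; exact: subset_closure.
Qed.

End normed.

Lemma rnorm_complete (V : completeNormedModType R[i]) (u : nat -> V) :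
  (forall e : R, 0 < e ->
    exists N, forall n m, (N <= n)%N -> (N <= m)%N -> rn (u n - u m) < e) ->
  exists l, forall e : R, 0 < e ->
    exists N, forall n, (N <= n)%N -> rn (l - u n) < e.
Proof.
move=> H.
have : cvg (u @ \oo).
  apply: cauchy_cvg; apply: cauchy_exP => e e0.
  have eE : e = (complex.Re e)%:C by rewrite RRe_real // gtr0_real.
  have [|N NH] := H (complex.Re e); first by rewrite -ltcR -eE.
  exists (u N); exists N => // n /= Nn.
  by rewrite -ball_normE /ball_ /= normrE_rnorm eE ltcR NH.
move=> /cvg_ex[l /cvgrPdist_lt ul]; exists l => e e0.
have [|N _ NH] := ul e%:C; first by rewrite ltcR.
by exists N => n /NH /=; rewrite normrE_rnorm ltcR.
Qed.

Lemma geometric_lt (M r e : R) : 0 <= r < 1 -> 0 < e ->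
  exists N, forall n, (N <= n)%N -> M * r ^+ n < e.
Proof.
move=> /andP[r0 r1] e0.
have /cvgrPdist_lt /(_ e e0)[N _ NH] : (fun n => M * r ^+ n) @ \oo --> (0 : R).
  by apply: cvg_geometric; rewrite ger0_norm.
exists N => n /NH /=; rewrite sub0r normrN; exact/le_lt_trans/ler_norm.
Qed.

Lemma geometric_complete (V : completeNormedModType R[i]) (u : nat -> V)
    (M r : R) : 0 <= r < 1 ->
  (forall n, rn (u n.+1 - u n) <= M * r ^+ n) ->
  exists l, forall e : R, 0 < e ->
    exists N, forall n, (N <= n)%N -> rn (l - u n) < e.
Proof.
move=> r01 ur; apply: rnorm_complete => e e0.
have /andP[r0 r1] := r01.
have r1' : 0 < 1 - r by rewrite subr_gt0.
have key n k : rn (u (n + k)%N - u n) <= M * r ^+ n * (1 - r ^+ k) / (1 - r).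
  elim: k => [|k IH].
    by rewrite addn0 subrr rnorm0 expr0 subrr mulr0 mul0r.
  rewrite addnS; apply: le_trans (ler_rnormB (u (n + k)%N) _ _) _.
  apply: le_trans (lerD (ur _) IH) _.
  rewrite le_eqVlt; apply/orP; left; apply/eqP; rewrite exprD exprS; field.
  by rewrite gt_eqF.
have M0 : 0 <= M.
  by have := le_trans (rnorm_ge0 _) (ur 0%N); rewrite expr0 mulr1.
have key2 n k : (n <= k)%N -> rn (u k - u n) <= M / (1 - r) * r ^+ n.
  move=> nk; rewrite -(subnKC nk); apply: le_trans (key _ _) _.
  rewrite [leRHS]mulrAC; apply: ler_wpM2r; first by rewrite invr_ge0 ltW.
  apply: ler_piMr; first by rewrite mulr_ge0 // exprn_ge0.
  by rewrite lerBlDr lerDl exprn_ge0.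
have [|N NH] := @geometric_lt (M / (1 - r)) r (e / 2) r01; first by lra.
exists N => n m Nn Nm.
have := key2 _ _ Nn; have := key2 _ _ Nm; have := NH N (leqnn _).
by have := ler_rnormB (u N) (u n) (u m); rewrite (rnormC (u N) (u m)); lra.
Qed.

End RealNorm.

Section CStarTheory.
Context {R : realType} {A : cstarAlgType R}.
Local Notation rn := rnorm.
Implicit Types x y z : A.

Lemma cmul0l x : 0 ** x = 0.
Proof. by apply: (addrI (0 ** x)); rewrite -cmulDl !addr0. Qed.

Lemma cmul0r x : x ** 0 = 0.
Proof. by apply: (addrI (x ** 0)); rewrite -cmulDr !addr0. Qed.

Lemma cmulNl x y : (- x) ** y = - (x ** y).
Proof. by apply: (addrI (x ** y)); rewrite -cmulDl !subrr cmul0l. Qed.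

Lemma cmulNr x y : x ** (- y) = - (x ** y).
Proof. by apply: (addrI (x ** y)); rewrite -cmulDr !subrr cmul0r. Qed.

Lemma cmulBl x y z : (x - y) ** z = x ** z - y ** z.
Proof. by rewrite cmulDl cmulNl. Qed.

Lemma cmulBr x y z : x ** (y - z) = x ** y - x ** z.
Proof. by rewrite cmulDr cmulNr. Qed.

Lemma cstar0 : cstar (0 : A) = 0.
Proof. by apply: (addrI (cstar 0)); rewrite -cstarD !addr0. Qed.

Lemma cstarN x : cstar (- x) = - cstar x.
Proof. by apply: (addrI (cstar x)); rewrite -cstarD !subrr cstar0. Qed.

Lemma cstarB x y : cstar (x - y) = cstar x - cstar y.
Proof. by rewrite cstarD cstarN. Qed.

Lemma rnormM x y : rn (x ** y) <= rn x * rn y.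
Proof.
by rewrite -lecR -normrE_rnorm rmorphM /= -!normrE_rnorm ler_cnormM.
Qed.

Lemma rnorm_starM x : rn (cstar x ** x) = rn x ^+ 2.
Proof.
by apply: (@complexI R); rewrite rmorphXn /= -!normrE_rnorm cnorm_star.
Qed.

Lemma rnorm_star x : rn (cstar x) = rn x.
Proof.
suff H y : rn y <= rn (cstar y).
  by apply/eqP; rewrite eq_le H andbT -{2}[x]cstarK H.
have [->|y0] := eqVneq (rn y) 0; first exact: rnorm_ge0.
have y_gt0 : 0 < rn y by rewrite lt0r y0 rnorm_ge0.
by rewrite -(ler_pM2r y_gt0) -expr2 -rnorm_starM rnormM.
Qed.

Lemma rnorm_lt_eq0 x : (forall e : R, 0 < e -> rn x < e) -> x = 0.
Proof.
move=> H; apply: rnorm_eq0; apply/eqP; rewrite eq_le rnorm_ge0 andbT.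
by apply/ler_addgt0Pr => e e0; rewrite add0r ltW // H.
Qed.

(* For self-adjoint [k] of norm less than 1, [1 - y] is the square root of
   [1 - k ^ 2] in the unitization. *)
Lemma cstar_sqrt (k : A) : cstar k = k -> rn k < 1 ->
  exists y, [/\ cstar y = y, k ** y = y ** k & y + y = k ** k + y ** y].
Proof.
move=> ks k1; set r := rn k in k1; have r0 : 0 <= r := rnorm_ge0 _.
pose h : R[i] := (2^-1 : R)%:C.
have h0 : (0 : R) <= 2^-1 by rewrite invr_ge0.
have hh x : h *: x + h *: x = x.
  rewrite -scalerDl /h -rmorphD /= (_ : 2^-1 + 2^-1 = 1 :> R) ?rmorph1 ?scale1r //.
  by lra.
pose f y := h *: (k ** k + y ** y).
pose u n := iter n f 0.
have uS n : u n.+1 = f (u n) by [].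
have contr a b : rn (f a - f b) <= 2^-1 * (rn a + rn b) * rn (a - b).
  rewrite -scalerBr rnormZr // -mulrA ler_wpM2l // opprD addrACA subrr add0r.
  rewrite (_ : a ** a - b ** b = a ** (a - b) + (a - b) ** b); last first.
    by rewrite cmulBl cmulBr addrA subrK.
  apply: le_trans (rnormD _ _) _; rewrite mulrDl.
  by apply: lerD; [exact: rnormM|rewrite mulrC rnormM].
have ur n : rn (u n) <= r.
  elim: n => [|n IH]; first by rewrite rnorm0.
  rewrite uS rnormZr //.
  have := rnormD (k ** k) (u n ** u n).
  have := rnormM k k; have := rnormM (u n) (u n).
  have : rn (u n) * rn (u n) <= r * r by rewrite ler_pM // rnorm_ge0.
  have : r * r <= r by rewrite ler_piMr // ltW.
  rewrite -/r; lra.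
have us n : cstar (u n) = u n.
  elim: n => [|n IH]; first exact: cstar0.
  by rewrite uS cstarZ conjc_real cstarD !cstarM ks IH.
have uk n : k ** u n = u n ** k.
  elim: n => [|n IH]; first by rewrite cmul0l cmul0r.
  rewrite uS -cscaleAr -cscaleAl cmulDr cmulDl !cmulA IH.
  by rewrite -(cmulA (u n) k) IH cmulA.
have [|n|l ul] := @geometric_complete R A u (rn (u 1%N)) r.
- by rewrite r0.
- elim: n => [|n IH]; first by rewrite subr0 expr0 mulr1.
  rewrite !uS exprS mulrCA; apply: le_trans (contr _ _) _.
  apply: ler_pM => //; rewrite ?rnorm_ge0 ?mulr_ge0 ?addr_ge0 ?rnorm_ge0 //.
  by have := ur n; have := ur n.+1; lra.
exists l; split.
- apply/eqP; rewrite -subr_eq0; apply/eqP/rnorm_lt_eq0 => e e0.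
  have [|N /(_ N (leqnn _)) lN] := ul (e / 2); first by lra.
  apply: le_lt_trans (ler_rnormB (u N) _ _) _.
  by rewrite -{1}us -cstarB rnorm_star (rnormC (u N)); lra.
- apply/eqP; rewrite -subr_eq0; apply/eqP/rnorm_lt_eq0 => e e0.
  have [|N /(_ N (leqnn _)) lN] := ul (e / 2); first by lra.
  apply: le_lt_trans (ler_rnormB (k ** u N) _ _) _.
  rewrite {2}uk -cmulBr -cmulBl.
  have := rnormM k (l - u N); have := rnormM (u N - l) k.
  have : r * rn (l - u N) <= rn (l - u N) by rewrite ler_piMl ?rnorm_ge0 // ltW.
  by rewrite -/r (rnormC (u N)); lra.
have lE : l = f l.
  apply/eqP; rewrite -subr_eq0; apply/eqP/rnorm_lt_eq0 => e e0.
  have M0 : 0 < 1 + (r + rn l) by have := rnorm_ge0 l; lra.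
  have [|N NH] := ul (e / 2 / (1 + (r + rn l))); first by rewrite !divr_gt0.
  have := NH _ (leqnn _); have := NH _ (leqnSn _).
  rewrite !ltr_pdivlMr // => l1 l2.
  apply: le_lt_trans (ler_rnormB (u N.+1) _ _) _.
  have := contr (u N) l; rewrite -uS (rnormC (u N)).
  have : 2^-1 * (rn (u N) + rn l) * rn (l - u N) <=
         2^-1 * (r + rn l) * rn (l - u N).
    by rewrite ler_wpM2r ?rnorm_ge0 // ler_wpM2l // lerD2r ur.
  have : 0 <= (r + rn l) * rn (l - u N.+1).
    by rewrite mulr_ge0 ?addr_ge0 ?rnorm_ge0.
  have := rnorm_ge0 (l - u N); lra.
have -> : l + l = f l + f l by rewrite -lE.
exact: hh.
Qed.

(* The operator of left multiplication by [1 - k ^ 2] is a contraction. *)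
Lemma cstar_contraction (k b : A) : cstar k = k -> rn k < 1 ->
  rn (b - k ** k ** b) <= rn b.
Proof.
move=> ks k1; have [y [ys yk yE]] := cstar_sqrt ks k1.
have sq c : c - y ** c - y ** (c - y ** c) = c - k ** k ** c.
  have -> : k ** k ** c = y ** c + y ** c - y ** y ** c.
    by rewrite -cmulDl yE cmulDl addrK.
  by rewrite cmulBr cmulA -[LHS]addrA -opprD addrA.
suff H c : rn (c - y ** c) <= rn c.
  by apply: le_trans (H b); apply: le_trans (H (b - y ** b)); rewrite sq.
pose p := k ** c; pose q := c - y ** c.
have pq : cstar p ** q = cstar q ** p.
  rewrite /p /q cstarB !cstarM ks ys cmulBr cmulBl; congr (_ - _).
    by rewrite cmulA.
  by rewrite !cmulA -(cmulA _ k) yk cmulA.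
have ppqq : cstar p ** p + cstar q ** q = cstar c ** c.
  rewrite /p {1}/q cstarB !cstarM ks ys -!cmulA cmulBl -cmulA -cmulBr -cmulDr.
  by congr (_ ** _); rewrite /q sq cmulA addrC subrK.
have Up (w : R[i]) : conjc w * w = 1 -> conjc w = - w -> rn (p + w *: q) = rn c.
  move=> w1 w2; apply/eqP.
  rewrite -(@eqrXn2 _ 2) ?rnorm_ge0 // -!rnorm_starM cstarD cstarZ.
  rewrite cmulDl !cmulDr -!cscaleAl -!cscaleAr scalerA w1 scale1r w2 -pq.
  by rewrite scaleNr addrA addrK ppqq.
have := Up 'i%C; have := Up (- 'i%C).
have ii : ('i%C : R[i]) ^+ 2 = -1 := sqr_i R.
have ij : conjc ('i%C : R[i]) = - 'i%C by apply/eqP; rewrite eq_complex /= oppr0 !eqxx.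
have ijN : conjc (- 'i%C : R[i]) = 'i%C.
  by apply/eqP; rewrite eq_complex /= oppr0 opprK !eqxx.
have n2i : complex.Re `|('i%C + 'i%C) : R[i]| = 2.
  by rewrite normc_def /= addr0 expr0n add0r sqrtr_sqr ger0_norm ?addr_ge0.
rewrite ij ijN !opprK mulrN mulNr -expr2 ii opprK.
move=> /(_ erefl erefl) Um /(_ erefl erefl) Ud.
have := rnormD (p + 'i%C *: q) (- (p + (- 'i%C) *: q)).
rewrite rnormN Um Ud opprD addrACA subrr add0r scaleNr opprK -scalerDl rnormZ.
rewrite n2i; lra.
Qed.
End CStarTheory.

Record closed_ideal (R : realType) (A : cstarAlgType R) := ClosedIdeal {
  ideal_set :> A -> Prop;
  ideal0 : ideal_set 0;
  idealD : forall x y, ideal_set x -> ideal_set y -> ideal_set (x + y);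
  idealZ : forall (a : R[i]) x, ideal_set x -> ideal_set (a *: x);
  idealMl : forall a x, ideal_set x -> ideal_set (a ** x);
  idealMr : forall a x, ideal_set x -> ideal_set (x ** a);
  ideal_closed : closed ideal_set
}.

Section Ideal.
Context {R : realType} {A : cstarAlgType R} (J : closed_ideal A).
Local Notation rn := rnorm.
Implicit Types x y z : A.

Lemma idealN x : J x -> J (- x).
Proof. by rewrite -scaleN1r; exact: idealZ. Qed.

Lemma idealB x y : J x -> J y -> J (x - y).
Proof. by move=> Jx Jy; apply: idealD => //; exact: idealN. Qed.

Lemma ideal_approx_unit x (e : R) : J x -> 0 < e ->
  exists u, [/\ J u, cstar u = u, forall b, rn (b - u ** b) <= rn b
              & rn (x - x ** u) < e].
Proof.
move=> Jx e0; pose h := cstar x ** x.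
have hs : cstar h = h by rewrite /h cstarM cstarK.
have h1 : 0 < 1 + rn h by have := rnorm_ge0 h; lra.
pose s := (1 + rn h)^-1; have s0 : 0 < s by rewrite invr_gt0.
pose k := s%:C *: h.
have ks : cstar k = k by rewrite cstarZ conjc_real hs.
have k1 : rn k < 1.
  by rewrite rnormZr ?ltW // mulrC ltr_pdivrMr // mul1r; lra.
have Jk : J k by apply: idealZ; exact: idealMl.
set K := k ** k; have JK : J K by exact: idealMl.
have Ks : cstar K = K by rewrite cstarM ks.
pose v n := iter n (fun v => v + (K - K ** v)) 0.
have vS n : v n.+1 = v n + (K - K ** v n) by [].
have Kv n : K ** v n = v n ** K.
  elim: n => [|n IH]; first by rewrite cmul0l cmul0r.
  by rewrite vS cmulDl cmulDr cmulBl cmulBr -[in RHS]cmulA -IH.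
have vs n : cstar (v n) = v n.
  elim: n => [|n IH]; first exact: cstar0.
  by rewrite vS cstarD cstarB cstarM IH Ks -Kv.
have Jv n : J (v n).
  elim: n => [|n IH]; first exact: ideal0.
  by rewrite vS; apply: idealD => //; apply: idealB => //; exact: idealMl.
have vE n b : v n.+1 ** b - v n ** b = K ** (b - v n ** b).
  by rewrite vS cmulDl addrAC subrr add0r cmulBl cmulBr cmulA.
have vn n b : rn (b - v n ** b) <= rn b.
  elim: n => [|n IH]; first by rewrite cmul0l subr0.
  apply: le_trans IH; apply: le_trans (cstar_contraction _ ks k1).
  by rewrite -/K -vE opprB addrA addrNK.
pose w n := iteri n (fun n w => w + v n) 0.
have wS n : w n.+1 = w n + v n by [].
have ws n : cstar (w n) = w n.
  by elim: n => [|n IH]; rewrite ?cstar0 // wS cstarD IH vs.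
have Jw n : J (w n).
  by elim: n => [|n IH]; [exact: ideal0|rewrite wS; exact: idealD].
have wE n b : K ** (n%:R *: b - w n ** b) = v n ** b.
  elim: n => [|n IH]; first by rewrite scale0r !cmul0l subr0 cmul0r.
  rewrite wS cmulDl -[in n.+1%:R]addn1 natrD scalerDl scale1r.
  by rewrite opprD addrACA cmulDr IH -vE addrC subrK.
have wn n b : rn (n%:R *: b - w n ** b) <= n%:R * rn b.
  elim: n => [|n IH]; first by rewrite scale0r cmul0l subr0 rnorm0 mul0r.
  rewrite wS cmulDl -[in n.+1%:R]addn1 natrD scalerDl scale1r.
  rewrite -[in leRHS]addn1 natrD mulrDl mul1r opprD addrACA.
  by apply: le_trans (rnormD _ _) _; apply: lerD.
pose d : R := e ^+ 4 * s ^+ 2.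
have d0 : 0 < d by rewrite mulr_gt0 ?exprn_gt0.
pose n := (Num.truncn (2 / d)).+1.
have nd : 2 / d < n%:R by rewrite truncnS_gt.
have n0 : 0 < n%:R :> R by [].
pose t : R := n%:R^-1.
have t0 : 0 <= t by rewrite invr_ge0.
have tn c : t%:C *: (n%:R *: c) = c :> A.
  rewrite scalerA (_ : _ * _ = 1) ?scale1r //.
  rewrite -(rmorph_nat (real_complex R)) -rmorphM /= /t mulVf ?rmorph1 //.
  by rewrite gt_eqF.
pose u := t%:C *: w n.
have uE b : b - u ** b = t%:C *: (n%:R *: b - w n ** b).
  by rewrite scalerBr tn cscaleAl.
have ub b : rn (b - u ** b) <= rn b.
  by rewrite uE rnormZr // /t mulrC ler_pdivrMr // mulrC.
have us : cstar u = u by rewrite cstarZ conjc_real ws.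
exists u; split => //; first exact: idealZ.
rewrite ltNge; apply/negP => ze.
pose z := cstar (x - x ** u); have zE : rn z = rn (x - x ** u) by rewrite rnorm_star.
rewrite -zE in ze.
have z0 : 0 < rn z by apply: lt_le_trans ze.
pose g := z - u ** z.
have gz : rn g <= rn z := ub z.
have xg : x ** g = cstar z ** z.
  by rewrite /g cmulBr cmulA -cmulBl /z cstarK.
have xgn : rn (x ** g) = rn z ^+ 2 by rewrite xg rnorm_starM.
have hgn : rn (x ** g) ^+ 2 <= rn z * rn (h ** g).
  rewrite -rnorm_starM cstarM -cmulA (cmulA (cstar x)).
  apply: le_trans (rnormM _ _) _; rewrite rnorm_star.
  by rewrite ler_wpM2r ?rnorm_ge0.
have Kgn : s ^+ 2 * rn (h ** g) ^+ 2 <= rn z * rn (K ** g).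
  have kg : s * rn (h ** g) = rn (k ** g) by rewrite -cscaleAl rnormZr // ltW.
  rewrite -exprMn kg -rnorm_starM cstarM -cmulA.
  rewrite (cmulA (cstar k)) ks.
  apply: le_trans (rnormM _ _) _; rewrite rnorm_star.
  by rewrite ler_wpM2r ?rnorm_ge0.
have Kg : rn (K ** g) * n%:R <= 2 * rn z.
  rewrite /g uE -cscaleAr wE rnormZr // /t mulrC mulrA divff ?gt_eqF // mul1r.
  have := rnormD (v n ** z - z) z; rewrite subrK (rnormC (v n ** z)).
  by have := vn n z; lra.
have Z3 : rn z ^+ 3 <= rn (h ** g).
  by rewrite -(ler_pM2l z0) -exprS (exprM _ 2 2) -xgn.
have Z6 : (rn z ^+ 3) ^+ 2 <= rn (h ** g) ^+ 2.
  by rewrite ler_sqr ?nnegrE ?rnorm_ge0 // exprn_ge0 // ltW.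
have : s ^+ 2 * (rn z ^+ 3) ^+ 2 * n%:R <= rn z * (2 * rn z).
  apply: (@le_trans _ _ (rn z * rn (K ** g) * n%:R)); last first.
    by rewrite -mulrA ler_wpM2l // rnorm_ge0.
  rewrite ler_wpM2r ?ler0n //; apply: le_trans Kgn.
  by rewrite ler_wpM2l // sqr_ge0.
rewrite [leLHS](_ : _ = s ^+ 2 * rn z ^+ 4 * n%:R * rn z ^+ 2); last by ring.
rewrite [leRHS](_ : _ = 2 * rn z ^+ 2); last by ring.
rewrite ler_pM2r ?exprn_gt0 //; apply/negP; rewrite -ltNge.
move: nd; rewrite ltr_pdivrMr // /d => nd; apply: lt_le_trans nd _.
rewrite mulrC ler_wpM2r ?ler0n // mulrC ler_wpM2l ?sqr_ge0 //.
by rewrite ler_pXn2r // nnegrE ltW.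
Qed.

Lemma ideal_star x : J x -> J (cstar x).
Proof.
move=> Jx; apply: closed_rnorm; first exact: ideal_closed.
move=> e /(ideal_approx_unit Jx)[u [Ju us _ xu]].
exists (u ** cstar x); first exact: idealMr.
by rewrite -rnorm_star cstarB cstarM cstarK us.
Qed.

Lemma ideal_cnorm_star x j (e : R) : J j -> 0 < e ->
  exists2 j', J j' & rn (x - j') ^+ 2 <= rn (cstar x ** x + j) + e.
Proof.
move=> Jj e0; have [u [Ju us ub ju]] := ideal_approx_unit Jj e0.
exists (x ** u); first exact: idealMl.
have ub' b : rn (b - b ** u) <= rn b.
  by rewrite -rnorm_star cstarB cstarM us -(rnorm_star b) ub.
rewrite -rnorm_starM cstarB cstarM us cmulBl -cmulA.
apply: le_trans (ub _) _; rewrite cmulBr cmulA.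
set M := cstar x ** x.
have -> : M - M ** u = (M + j) - (M + j) ** u - (j - j ** u).
  by rewrite cmulDl opprD addrACA addrK.
apply: le_trans (rnormD _ _) _; rewrite rnormN.
by apply: lerD (ub' _) _; rewrite ltW.
Qed.
End Ideal.

Definition ideal_pred (R : realType) (A : cstarAlgType R) (J : closed_ideal A)
  : {pred A} := fun x => `[< J x >].

Section IdealPred.
Context {R : realType} {A : cstarAlgType R} (J : closed_ideal A).

Lemma ideal_predP x : reflect (J x) (x \in ideal_pred J).
Proof. exact: asboolP. Qed.

Fact ideal_pred_zmod_closed : zmod_closed (ideal_pred J).
Proof.
split; first exact/ideal_predP/ideal0.
by move=> x y /ideal_predP Jx /ideal_predP Jy; apply/ideal_predP/idealB.
Qed.

HB.instance Definition _ :=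
  GRing.isZmodClosed.Build A (ideal_pred J) ideal_pred_zmod_closed.

End IdealPred.

Definition quotient (R : realType) (A : cstarAlgType R) (J : closed_ideal A) :=
  Quotient.quot (ideal_pred J).

Section QuotientAlgebra.
Context {R : realType} {A : cstarAlgType R} (J : closed_ideal A).
Local Notation rn := rnorm.
Local Notation Q := (quotient J).
Implicit Types (x y : A) (p q : Q).

HB.instance Definition _ := GRing.Zmodule.on Q.
HB.instance Definition _ := Quotient.on Q.

Definition quotient_pi (x : A) : Q := \pi_Q x.
Local Notation pi := quotient_pi.

Lemma quotient_piP x y : pi x = pi y <-> J (x - y).
Proof.
rewrite /pi; split => [/eqP|Jxy].
  by rewrite -Quotient.idealrBE => /ideal_predP.
by apply/eqP; rewrite -Quotient.idealrBE; apply/ideal_predP.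
Qed.

Lemma quotient_reprK q : pi (repr q) = q.
Proof. exact: reprK. Qed.

Lemma quotient_piD x y : pi (x + y) = pi x + pi y.
Proof. by rewrite /pi !piE. Qed.

Lemma quotient_piN x : pi (- x) = - pi x.
Proof. by rewrite /pi !piE. Qed.

Lemma quotient_pi0 : pi 0 = 0.
Proof. by rewrite /pi !piE. Qed.

Lemma quotient_pi_repr x : J (repr (pi x) - x).
Proof. by apply/quotient_piP; rewrite quotient_reprK. Qed.

Definition quotient_scale (a : R[i]) q : Q := pi (a *: repr q).
Definition quotient_mul p q : Q := pi (repr p ** repr q).
Definition quotient_star q : Q := pi (cstar (repr q)).
Definition quotient_norm q : R := inf [set rn x | x in [set x | pi x = q]].

Lemma quotient_piZ a x : pi (a *: x) = quotient_scale a (pi x).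
Proof.
apply/esym/quotient_piP; rewrite -scalerBr; apply: idealZ.
exact: quotient_pi_repr.
Qed.

Lemma quotient_piM x y : pi (x ** y) = quotient_mul (pi x) (pi y).
Proof.
apply/esym/quotient_piP.
rewrite -(subrK (x ** repr (pi y)) (_ ** _)) -cmulBl -addrA -cmulBr.
by apply: idealD; [apply: idealMr|apply: idealMl]; exact: quotient_pi_repr.
Qed.

Lemma quotient_piS x : pi (cstar x) = quotient_star (pi x).
Proof.
apply/esym/quotient_piP; rewrite -cstarB; apply: ideal_star.
exact: quotient_pi_repr.
Qed.

Lemma quotient_norm_has_inf q : has_inf [set rn x | x in [set x | pi x = q]].
Proof.
split; first by exists (rn (repr q)), (repr q) => //; exact: quotient_reprK.
by exists 0 => _ [x _ <-]; exact: rnorm_ge0.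
Qed.

Lemma quotient_norm_le x : quotient_norm (pi x) <= rn x.
Proof. by apply: ge_inf; [case: (quotient_norm_has_inf (pi x))|exists x]. Qed.

Lemma quotient_norm_lt q (e : R) : quotient_norm q < e ->
  exists2 x, pi x = q & rn x < e.
Proof.
move=> qe; have [|_ [x xq <-] xe] := @inf_adherent _ _ (e - quotient_norm q) _
  (quotient_norm_has_inf q); first by rewrite subr_gt0.
by exists x => //; move: xe; rewrite -/(quotient_norm q) addrC subrK.
Qed.

Lemma quotient_norm_adherent q (e : R) : 0 < e ->
  exists2 x, pi x = q & rn x < quotient_norm q + e.
Proof. by move=> e0; apply: quotient_norm_lt; rewrite ltrDl. Qed.

Lemma quotient_norm_ge0 q : 0 <= quotient_norm q.
Proof.
apply: lb_le_inf; first by case: (quotient_norm_has_inf q).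
by move=> _ [x _ <-]; exact: rnorm_ge0.
Qed.

Fact quotient_scaleA a b q :
  quotient_scale a (quotient_scale b q) = quotient_scale (a * b) q.
Proof. by rewrite -[q]quotient_reprK -!quotient_piZ scalerA. Qed.

Fact quotient_scale1 : left_id 1 quotient_scale.
Proof. by move=> q; rewrite -[q]quotient_reprK -!quotient_piZ scale1r. Qed.

Fact quotient_scaleDr : right_distributive quotient_scale +%R.
Proof.
move=> a p q; rewrite -[p]quotient_reprK -[q]quotient_reprK.
by rewrite -!(quotient_piD, quotient_piZ) scalerDr.
Qed.

Fact quotient_scaleDl q : {morph quotient_scale^~ q : a b / a + b}.
Proof.
move=> a b; rewrite -[q]quotient_reprK.
by rewrite -!(quotient_piD, quotient_piZ) scalerDl.
Qed.

HB.instance Definition _ := GRing.Zmodule_isLmodule.Build R[i] Q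
  quotient_scaleA quotient_scale1 quotient_scaleDr quotient_scaleDl.

Lemma quotient_scaleE a q : a *: q = quotient_scale a q.
Proof. by []. Qed.

Fact quotient_normD p q :
  (quotient_norm (p + q))%:C <= (quotient_norm p)%:C + (quotient_norm q)%:C.
Proof.
rewrite -rmorphD lecR; apply/ler_addgt0Pr => e e0.
have [|x <- xp] := @quotient_norm_adherent p (e / 2); first by lra.
have [|y <- yq] := @quotient_norm_adherent q (e / 2); first by lra.
rewrite -quotient_piD; have := quotient_norm_le (x + y).
by have := rnormD x y; lra.
Qed.

Lemma quotient_normZ_le a q :
  quotient_norm (a *: q) <= complex.Re `|a| * quotient_norm q.
Proof.
have a0 : 0 <= complex.Re `|a| by rewrite -ler0c RRe_real ?normr_real ?normr_ge0.
apply/ler_addgt0Pr => e e0; pose d := e / (1 + complex.Re `|a|).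
have d0 : 0 < d by rewrite divr_gt0 //; lra.
have de : complex.Re `|a| * d <= e.
  by rewrite /d mulrCA ler_piMr ?(ltW e0) // ler_pdivrMr; lra.
have [x <- xq] := @quotient_norm_adherent q d d0.
rewrite quotient_scaleE -quotient_piZ.
apply: le_trans (quotient_norm_le _) _; rewrite rnormZ.
apply: (@le_trans _ _ (complex.Re `|a| * (quotient_norm (pi x) + d))).
  by rewrite ler_wpM2l // ltW.
by rewrite mulrDr lerD2l.
Qed.

Fact quotient_normZ (a : R[i]) q :
  (quotient_norm (a *: q))%:C = `|a| * (quotient_norm q)%:C.
Proof.
have aE (b : R[i]) : `|b| = (complex.Re `|b|)%:C by rewrite RRe_real ?normr_real.
rewrite aE -rmorphM; congr _%:C; apply/eqP; rewrite eq_le quotient_normZ_le andTb.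
have [->|a0] := eqVneq a 0.
  by rewrite normr0 mul0r quotient_norm_ge0.
have := quotient_normZ_le a^-1 (a *: q); rewrite scalerA mulVf // scale1r.
have r0 : 0 < complex.Re `|a| by rewrite -ltcR -aE normr_gt0.
rewrite (_ : complex.Re `|a^-1| = (complex.Re `|a|)^-1).
  by rewrite ler_pdivlMl.
by apply: (@complexI R); rewrite -aE fmorphV /= -aE normfV.
Qed.

Fact quotient_norm_eq0 q : (quotient_norm q)%:C = 0 -> q = 0.
Proof.
move=> [] q0; rewrite -[q]quotient_reprK -quotient_pi0; apply/quotient_piP.
rewrite subr0; apply: closed_rnorm; first exact: ideal_closed.
move=> e e0; have [|x xq xe] := @quotient_norm_lt q e; first by rewrite q0.
exists (repr q - x); first by apply/quotient_piP; rewrite quotient_reprK.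
by rewrite opprB addrC subrK.
Qed.

HB.instance Definition _ := Lmodule_isNormed.Build R[i] Q
  quotient_normD quotient_normZ quotient_norm_eq0.

Lemma quotient_normE q : `|q| = (quotient_norm q)%:C.
Proof. by []. Qed.

Lemma quotient_rnormE q : rn q = quotient_norm q.
Proof. by []. Qed.

End QuotientAlgebra.

Section QuotientCStar.
Context {R : realType} {A : cstarAlgType R} (J : closed_ideal A).
Local Notation rn := rnorm.
Local Notation Q := (quotient J).
Local Notation pi := (quotient_pi J).
Implicit Types (x y : A) (p q r : Q).

Fact quotient_complete (F : set_system Q) : ProperFilter F -> cauchy F -> cvg F.
Proof.
move=> FF /cauchyP Fc.
have /choice[s Fs] n : exists q : Q, F (ball q (2^-1 ^+ n : R)%:C).
  by apply: Fc; rewrite ltcR exprn_gt0 ?invr_gt0.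
have ballE (q : Q) (e : R) z : ball q e%:C z -> rn (q - z) < e.
  by rewrite -ball_normE /ball_ /= normrE_rnorm ltcR.
have sS n : quotient_norm (s n.+1 - s n) < 2 * 2^-1 ^+ n.
  have [z [/ballE z1 /ballE z2]] := filter_ex (filterI (Fs n.+1) (Fs n)).
  rewrite -quotient_rnormE; have := ler_rnormB z (s n.+1) (s n).
  rewrite (rnormC z); move: z1; rewrite exprS; move: z2.
  by have : 0 < 2^-1 ^+ n :> R; [rewrite exprn_gt0 ?invr_gt0|lra].
have /choice[d dE] n : exists d : A,
    pi d = s n.+1 - s n /\ rn d < 2 * 2^-1 ^+ n.
  by have [d ? ?] := quotient_norm_lt (sS n); exists d.
pose u n := iteri n (fun n x => x + d n) (repr (s 0%N)).
have uS n : u n.+1 = u n + d n by [].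
have us n : pi (u n) = s n.
  elim: n => [|n IH]; first exact: quotient_reprK.
  by rewrite uS quotient_piD IH (dE n).1 addrC subrK.
have [| |l ul] := @geometric_complete R A u 2 2^-1.
- by apply/andP; split; lra.
- by move=> n; rewrite uS addrC addKr ltW // (dE n).2.
apply/cvg_ex; exists (pi l); apply/cvgrPdist_lt => e e0.
have eE : e = (complex.Re e)%:C by rewrite RRe_real // gtr0_real.
set f := complex.Re e in eE; have f0 : 0 < f by rewrite -ltcR -eE.
have [|N1 H1] := ul (f / 2); first by lra.
have [||N2 H2] := @geometric_lt R 1 2^-1 (f / 2); [by apply/andP; split; lra|lra|].
pose N := maxn N1 N2.
apply: filterS (Fs N) => z /ballE sz.
rewrite eE normrE_rnorm ltcR.
apply: le_lt_trans (ler_rnormB (s N) _ _) _.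
have := H2 N (leq_maxr _ _); rewrite mul1r.
have := H1 N (leq_maxl _ _).
have : rn (pi l - s N) <= rn (l - u N).
  rewrite -us -quotient_piN -quotient_piD quotient_rnormE.
  exact: quotient_norm_le.
by lra.
Qed.

HB.instance Definition _ := Uniform_isComplete.Build Q quotient_complete.

Local Notation mul := (@quotient_mul R A J).
Local Notation star := (@quotient_star R A J).

Fact quotient_mulA : associative mul.
Proof.
move=> p q r.
rewrite -[p]quotient_reprK -[q]quotient_reprK -[r]quotient_reprK.
by rewrite -!quotient_piM cmulA.
Qed.

Fact quotient_mulDl : left_distributive mul +%R.
Proof.
move=> p q r.
rewrite -[p]quotient_reprK -[q]quotient_reprK -[r]quotient_reprK.
by rewrite -!(quotient_piD, quotient_piM) cmulDl.
Qed.

Fact quotient_mulDr : right_distributive mul +%R.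
Proof.
move=> p q r.
rewrite -[p]quotient_reprK -[q]quotient_reprK -[r]quotient_reprK.
by rewrite -!(quotient_piD, quotient_piM) cmulDr.
Qed.

Fact quotient_scaleAl (a : R[i]) p q : a *: mul p q = mul (a *: p) q.
Proof.
rewrite !quotient_scaleE -[p]quotient_reprK -[q]quotient_reprK.
by rewrite -!(quotient_piZ, quotient_piM) cscaleAl.
Qed.

Fact quotient_scaleAr (a : R[i]) p q : a *: mul p q = mul p (a *: q).
Proof.
rewrite !quotient_scaleE -[p]quotient_reprK -[q]quotient_reprK.
by rewrite -!(quotient_piZ, quotient_piM) cscaleAr.
Qed.

Fact quotient_starK : involutive star.
Proof. by move=> p; rewrite -[p]quotient_reprK -!quotient_piS cstarK. Qed.

Fact quotient_starD : {morph star : p q / p + q}.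
Proof.
move=> p q; rewrite -[p]quotient_reprK -[q]quotient_reprK.
by rewrite -!(quotient_piD, quotient_piS) cstarD.
Qed.

Fact quotient_starZ (a : R[i]) p : star (a *: p) = conjc a *: star p.
Proof.
rewrite !quotient_scaleE -[p]quotient_reprK.
by rewrite -!(quotient_piZ, quotient_piS) cstarZ.
Qed.

Fact quotient_starM p q : star (mul p q) = mul (star q) (star p).
Proof.
rewrite -[p]quotient_reprK -[q]quotient_reprK.
by rewrite -!(quotient_piM, quotient_piS) cstarM.
Qed.

Fact quotient_normM p q : `|mul p q| <= `|p| * `|q|.
Proof.
rewrite !quotient_normE -rmorphM lecR.
change (quotient_norm (mul p q) <= quotient_norm p * quotient_norm q :> R).
apply/ler_addgt0Pr => e e0.
set a := quotient_norm p; set b := quotient_norm q.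
have a0 : 0 <= a := quotient_norm_ge0 p.
have b0 : 0 <= b := quotient_norm_ge0 q.
pose d := Num.min 1 (e / (a + b + 1)).
have ab0 : 0 < a + b + 1 by lra.
have d0 : 0 < d by rewrite lt_min ltr01 divr_gt0.
have d1 : d <= 1 by rewrite ge_min lexx.
have de : d * (a + b + 1) <= e by rewrite -ler_pdivlMr // ge_min lexx orbT.
have [x xp xa] := quotient_norm_adherent p d0.
have [y yq yb] := quotient_norm_adherent q d0.
rewrite -{}xp -{}yq -quotient_piM; apply: le_trans (quotient_norm_le _ _) _.
apply: le_trans (rnormM _ _) _.
apply: (@le_trans _ _ ((a + d) * (b + d))).
  by rewrite ler_pM ?rnorm_ge0 // ltW.
have : d * d <= d by rewrite ler_piMr // ltW.
nra.
Qed.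

Fact quotient_norm_star p : `|mul (star p) p| = `|p| ^+ 2.
Proof.
rewrite !quotient_normE -rmorphXn; congr _%:C; apply/eqP; rewrite eq_le.
apply/andP; split; apply/ler_addgt0Pr => e e0; last first.
  have [|z zp ze] := @quotient_norm_adherent _ _ J (mul (star p) p) (e / 2).
    by lra.
  pose x := repr p; have xp : pi x = p := quotient_reprK p.
  have Jj : J (z - cstar x ** x).
    by apply/quotient_piP; rewrite zp quotient_piM quotient_piS xp.
  have [|j Jj' H] := @ideal_cnorm_star _ _ J x _ (e / 2) Jj; first by lra.
  apply: (@le_trans _ _ (rn (x - j) ^+ 2)).
    rewrite ler_sqr ?nnegrE ?rnorm_ge0 ?quotient_norm_ge0 //.
    rewrite -xp (_ : pi x = pi (x - j)) ?quotient_norm_le //.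
    by apply/quotient_piP; rewrite opprB addrC subrK.
  by move: H; rewrite (addrC (cstar x ** x)) subrK; lra.
set a := quotient_norm p; have a0 : 0 <= a := quotient_norm_ge0 p.
pose d := Num.min 1 (e / (a + a + 1)).
have ab0 : 0 < a + a + 1 by lra.
have d0 : 0 < d by rewrite lt_min ltr01 divr_gt0.
have d1 : d <= 1 by rewrite ge_min lexx.
have de : d * (a + a + 1) <= e by rewrite -ler_pdivlMr // ge_min lexx orbT.
have [x xp xa] := quotient_norm_adherent p d0.
rewrite -{}xp -quotient_piS -quotient_piM.
apply: le_trans (quotient_norm_le _ _) _; rewrite rnorm_starM.
apply: (@le_trans _ _ ((a + d) ^+ 2)).
  by rewrite ler_sqr ?nnegrE ?rnorm_ge0 ?(addr_ge0 a0 (ltW d0)) // ltW.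
have : d * d <= d by rewrite ler_piMr // ltW.
nra.
Qed.

HB.instance Definition _ := isCStarAlgebra.Build R Q
  quotient_mulA quotient_mulDl quotient_mulDr quotient_scaleAl quotient_scaleAr
  quotient_starK quotient_starD quotient_starZ quotient_starM
  quotient_normM quotient_norm_star.

End QuotientCStar.

Section QuotientMorphisms.
Context {R : realType} {A : cstarAlgType R}.
Implicit Types J K : closed_ideal A.

Fact quotient_pi_linear J : linear (quotient_pi J).
Proof. by move=> a x y; rewrite quotient_piD quotient_piZ. Qed.

HB.instance Definition _ J :=
  GRing.isLinear.Build R[i] A (quotient J) _ (quotient_pi J)
    (quotient_pi_linear J).

HB.instance Definition _ J :=
  isStarMorphism.Build R A (quotient J) (quotient_pi J)
    (@quotient_piM R A J) (@quotient_piS R A J).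

(* Sends x + J to x + K; only meaningful when J is contained in K. *)
Definition quotient_map J K (q : quotient J) : quotient K :=
  quotient_pi K (repr q).

Lemma quotient_mapE J K x : J `<=` K ->
  quotient_map K (quotient_pi J x) = quotient_pi K x.
Proof. by move=> JK; apply/quotient_piP/JK/quotient_pi_repr. Qed.

Section IdealLim.
Context (J : nat -> closed_ideal A) (Jincr : forall k, J k `<=` J k.+1).
Let U : set A := \bigcup_k J k.

Lemma ideal_incr m n : (m <= n)%N -> J m `<=` J n.
Proof.
elim: n => [|n IH]; first by rewrite leqn0 => /eqP ->.
by rewrite leq_eqVlt ltnS => /predU1P[->//|/IH mn] x /mn; exact: Jincr.
Qed.

Let lift1 (f : A -> A) (c : R) : 0 <= c ->
  (forall x y, rnorm (f x - f y) <= c * rnorm (x - y)) ->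
  (forall k x, J k x -> J k (f x)) ->
  forall x, closure U x -> closure U (f x).
Proof.
move=> c0 fc fJ x Ux; apply: rnorm_closure => e e0.
have [|y [k _ Jy] xy] := closure_rnorm Ux (e := e / (c + 1)).
  by rewrite divr_gt0 //; lra.
exists (f y); first by exists k => //; exact: fJ.
apply: le_lt_trans (fc _ _) _.
apply: (@le_lt_trans _ _ ((c + 1) * rnorm (x - y))).
  by rewrite ler_wpM2r ?rnorm_ge0 //; lra.
by rewrite mulrC -ltr_pdivlMr //; lra.
Qed.

Fact ideal_lim0 : closure U 0.
Proof. by apply: subset_closure; exists 0%N => //; exact: ideal0. Qed.

Fact ideal_limD x y : closure U x -> closure U y -> closure U (x + y).
Proof.
move=> Ux Uy; apply: rnorm_closure => e e0.
have e2 : 0 < e / 2 by lra.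
have [x' [m _ Jx] xx] := closure_rnorm Ux e2.
have [y' [n _ Jy] yy] := closure_rnorm Uy e2.
exists (x' + y').
  exists (maxn m n) => //; apply: idealD.
  - exact: ideal_incr (leq_maxl _ _) _ Jx.
  - exact: ideal_incr (leq_maxr _ _) _ Jy.
rewrite opprD addrACA; have := rnormD (x - x') (y - y'); lra.
Qed.

Fact ideal_limZ (a : R[i]) x : closure U x -> closure U (a *: x).
Proof.
apply: (@lift1 (fun x => a *: x) (complex.Re `|a|)).
- by rewrite -ler0c RRe_real ?normr_real ?normr_ge0.
- by move=> y z; rewrite -scalerBr rnormZ.
- by move=> k y; exact: idealZ.
Qed.

Fact ideal_limMl a x : closure U x -> closure U (a ** x).
Proof.
apply: (@lift1 (fun x => a ** x) (rnorm a)); first exact: rnorm_ge0.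
- by move=> y z; rewrite -cmulBr rnormM.
- by move=> k y; exact: idealMl.
Qed.

Fact ideal_limMr a x : closure U x -> closure U (x ** a).
Proof.
apply: (@lift1 (fun x => x ** a) (rnorm a)); first exact: rnorm_ge0.
- by move=> y z; rewrite -cmulBl mulrC rnormM.
- by move=> k y; exact: idealMr.
Qed.

Definition ideal_lim : closed_ideal A := @ClosedIdeal R A
  (closure (\bigcup_k J k)) ideal_lim0 ideal_limD ideal_limZ
  ideal_limMl ideal_limMr (@closed_closure _ _).

End IdealLim.
End QuotientMorphisms.

Section AC.
Context {R : realType}.
Implicit Types A B C : cstarAlgType R.

Definition separable A := exists2 D : set A, countable D & dense D.

Definition weakly_semiprojective A :=
  forall C (J : nat -> closed_ideal C) (Jincr : forall k, J k `<=` J k.+1)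
    (sigma : {starmorphism A -> quotient (ideal_lim Jincr)})
    (eps : R) (F : set A), 0 < eps -> finite_set F ->
  exists k (psi : {starmorphism A -> quotient (J k)}),
    forall x, F x ->
      `|quotient_map (ideal_lim Jincr) (psi x) - sigma x| < eps%:C.

Definition is_cocone (C : nat -> cstarAlgType R)
    (phi : forall n, {starmorphism C n -> C n.+1}) A
    (alpha : forall n, {starmorphism C n -> A}) :=
  forall n x, alpha n.+1 (phi n x) = alpha n x.

(* The inductive limit is the colimit in the category of C*-algebras, so that
   this determines [A] and [alpha] up to isomorphism. *)
Definition is_inductive_limit (C : nat -> cstarAlgType R)
    (phi : forall n, {starmorphism C n -> C n.+1}) A
    (alpha : forall n, {starmorphism C n -> A}) :=
  is_cocone phi alpha /\
  forall B (beta : forall n, {starmorphism C n -> B}), is_cocone phi beta ->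
    exists f : {starmorphism A -> B},
      (forall n x, f (alpha n x) = beta n x) /\
      forall g : {starmorphism A -> B},
        (forall n x, g (alpha n x) = beta n x) -> g =1 f.

Definition AC_algebra (Cls : cstarAlgType R -> Prop) A :=
  exists (C : nat -> cstarAlgType R)
    (phi : forall n, {starmorphism C n -> C n.+1})
    (alpha : forall n, {starmorphism C n -> A}),
    (forall n, Cls (C n)) /\ is_inductive_limit phi alpha.

Definition AAC_algebra (Cls : cstarAlgType R -> Prop) A :=
  AC_algebra (AC_algebra Cls) A.

End AC.

(* Main.v *)
(* A *-morphism gamma from a weakly semiprojective C to an inductive limit of
   algebras B n induces a morphism from C to prod B n / c_0, the quotient of
   prod B n by the closure of the ideals of sequences vanishing from k on.
   Weak semiprojectivity lifts it, on a finite set and up to epsilon, to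
   sequences defined from some k on, whose components factor gamma approximately
   through B n while hardly increasing norms. For an AAC-algebra A two such lifts
   factor every C -> A with C in the class approximately through another
   algebra of the class, whose image can be taken to almost contain a given
   finite set. Iterating along dense sequences gives a system C 0 -> C 1 -> ...
   in the class with maps to A that commute up to 2^-k on growing finite sets.
   Their limits form a cocone with dense union of images, and the norm of the
   image in A of an element of C n is the limit of its norms along the system;
   hence A is the inductive limit. *)
Require Import Defs.
From HB Require Import structures.
From mathcomp Require Import all_boot all_order all_algebra complex.
From mathcomp Require Import boolp classical_sets functions cardinality reals.
From mathcomp Require Import topology normedtype sequences.
From mathcomp Require Import ring lra.

Set Implicit Arguments.
Unset Strict Implicit.
Unset Printing Implicit Defensive.
Import Order.TTheory GRing.Theory Num.Theory.
Import numFieldNormedType.Exports.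

Local Open Scope classical_set_scope.
Local Open Scope ring_scope.
Local Open Scope complex_scope.
Local Open Scope cstar_scope.

Local Notation rn := rnorm.

(** * Star-morphisms are contractive *)

Section Contractive.
Context {R : realType}.

(** In the unitization the relations say that [1 - y] is self-adjoint, commutes with [k] and has
    square [1 - k ** k], so [k] and [1 - y] act like a cosine and a sine. Being purely algebraic,
    these hypotheses survive the application of a morphism. *)
Lemma sqrt_complement_contraction (B : cstarAlgType R) (k y c : B) :
  cstar k = k -> cstar y = y -> k ** y = y ** k -> y + y = k ** k + y ** y ->
  rn (k ** c) <= rn c.
Proof.
move=> ks ys ky yE; pose p := k ** c; pose q := c - y ** c.
have pq : cstar p ** q = cstar q ** p.
  rewrite /p /q cstarB !cstarM ks ys cmulBr cmulBl !cmulA.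
  by rewrite -(cmulA _ k y) ky cmulA.
have ppqq : cstar p ** p + cstar q ** q = cstar c ** c.
  have -> : q = c - y ** c by [].
  rewrite cstarB !cstarM ks ys cmulBl !cmulBr !cmulA.
  have : cstar c ** (y + y) ** c = cstar c ** (k ** k + y ** y) ** c by rewrite yE.
  rewrite !cmulDr !cmulDl !cmulA => H.
  set X := _ ** k ** c in H *; set Y := _ ** c in H *; set Z := _ ** y ** c in H *.
  have -> : Y - Z = X - Y by apply/eqP; rewrite subr_eq addrAC -H addrK.
  by rewrite opprB !addrA subrK addrC addKr.
(* [p + 'i q] and [p - 'i q] have the norm of [c]. *)
have Up (w : R[i]) : conjc w * w = 1 -> conjc w = - w -> rn (p + w *: q) = rn c.
  move=> w1 w2; apply/eqP.
  rewrite -(@eqrXn2 _ 2) ?rnorm_ge0 // -!rnorm_starM cstarD cstarZ.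
  rewrite cmulDl !cmulDr -!cscaleAl -!cscaleAr scalerA w1 scale1r w2 -pq.
  by rewrite scaleNr addrA addrK ppqq.
have [w [w1 w2]] : exists w : R[i], conjc w * w = 1 /\ conjc w = - w.
  have ij : conjc ('i%C : R[i]) = - 'i%C.
    by apply/eqP; rewrite eq_complex /= oppr0 !eqxx.
  exists 'i%C; split; last exact: ij.
  by apply/eqP; rewrite eq_complex /= !mul0r mulr0 mulN1r opprK add0r addr0 !eqxx.
have U1 : rn (p + w *: q) = rn c by exact: Up.
have U2 : rn (p + - w *: q) = rn c by apply: Up; rewrite rmorphN ?mulrNN //= w2.
have := rnormD (p + w *: q) (p + - w *: q).
rewrite U1 U2 addrACA -scalerDl subrr scale0r addr0 -mulr2n -scaler_nat.
by rewrite rnormZ normr_nat -(rmorph_nat (real_complex R)) /= -/p; lra.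
Qed.

(** For self-adjoint [k] of norm below 1, the images of [k] and of its [cstar_sqrt] companion
    satisfy the same relations, so left multiplication by [f k] is contractive; applied to [f k]
    itself this bounds its norm by 1. Scaling gives all self-adjoint elements, and the C*-identity
    gives the rest. *)
Lemma starmorphism_norm (A B : cstarAlgType R) (f : {starmorphism A -> B}) x :
  rn (f x) <= rn x.
Proof.
have sa1 k : cstar k = k -> rn k < 1 -> rn (f k) <= 1.
  move=> ks k1; have [y [ys ky yE]] := cstar_sqrt ks k1.
  have fs : cstar (f k) = f k by rewrite -starmS ks.
  have : rn (f k ** f k) <= rn (f k).
    apply: (@sqrt_complement_contraction _ _ (f y)) => //.
    - by rewrite -starmS ys.
    - by rewrite -!starmM ky.
    - by rewrite -!starmM -!raddfD /= yE.
  rewrite -{1}fs rnorm_starM.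
  have [->|] := eqVneq (rn (f k)) 0; first by rewrite ler01.
  move=> n0; have f0 : 0 < rn (f k) by rewrite lt0r n0 rnorm_ge0.
  by rewrite expr2 ger_pMr.
have sa k : cstar k = k -> rn (f k) <= rn k.
  move=> ks; apply/ler_addgt0Pr => e e0.
  have ke : 0 < rn k + e by have := rnorm_ge0 k; lra.
  have i0 : 0 <= (rn k + e)^-1 by rewrite invr_ge0 ltW.
  (* The extra [e] makes the scaled norm strictly below 1 and covers [k = 0]. *)
  have := sa1 ((rn k + e)^-1%:C *: k); rewrite linearZ /= cstarZ conjc_real ks.
  rewrite !rnormZr // mulrC ltr_pdivrMr // mul1r ltrDl e0.
  by move=> /(_ erefl isT); rewrite mulrC ler_pdivrMr // mul1r.
have := sa (cstar x ** x); rewrite starmM starmS !rnorm_starM cstarM cstarK.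
by move=> /(_ erefl); rewrite ler_sqr // nnegrE rnorm_ge0.
Qed.

End Contractive.

(** * Convergence of sequences and its compatibility with the operations *)

Section Convergence.
Context {R : realType}.

(** Stated with the real-valued norm, so that all estimates take place in the ordered field [R]
    rather than in [R[i]]. *)
Definition rcvg (V : normedModType R[i]) (u : nat -> V) (l : V) :=
  forall e : R, 0 < e -> exists N, forall n, (N <= n)%N -> rn (l - u n) < e.

Definition rcauchy (V : normedModType R[i]) (u : nat -> V) :=
  forall e : R, 0 < e -> exists N, forall n m, (N <= n)%N -> (N <= m)%N ->
    rn (u n - u m) < e.

Lemma rcauchy_rcvg (V : completeNormedModType R[i]) (u : nat -> V) :
  rcauchy u -> exists l, rcvg u l.
Proof. exact: rnorm_complete. Qed.

Lemma eventually_and (P Q : nat -> Prop) :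
  (exists N, forall n, (N <= n)%N -> P n) ->
  (exists N, forall n, (N <= n)%N -> Q n) ->
  exists N, forall n, (N <= n)%N -> P n /\ Q n.
Proof.
move=> [M PM] [N QN]; exists (maxn M N) => n; rewrite geq_max => /andP[? ?].
by split; [exact: PM|exact: QN].
Qed.

Lemma eventually_ltn (p : nat) (P : nat -> nat -> Prop) :
  (forall i, (i < p)%N -> exists N, forall n, (N <= n)%N -> P i n) ->
  exists N, forall n, (N <= n)%N -> forall i, (i < p)%N -> P i n.
Proof.
elim: p => [|p IH] H; first by exists 0%N.
have [|N NH] := eventually_and (IH _) (H p (leqnn _)).
  by move=> i ip; apply: H; exact: ltnW.
exists N => n /NH[Pi Pp] i; rewrite ltnS leq_eqVlt => /predU1P[->//|]; exact: Pi.
Qed.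

Lemma exp_half_lt (e : R) : 0 < e ->
  exists N, forall n, (N <= n)%N -> 2^-1 ^+ n < e :> R.
Proof.
move=> e0; have [||N NH] := @geometric_lt R 1 2^-1 e => //.
  by apply/andP; split; lra.
by exists N => n /NH; rewrite mul1r.
Qed.

Lemma exp_half_gt0 n : 0 < 2^-1 ^+ n :> R.
Proof. by rewrite exprn_gt0 ?invr_gt0. Qed.

Section normed.
Context {V : normedModType R[i]}.
Implicit Types (u v : nat -> V) (l m : V).

Lemma rnorm_lt0_eq l m : (forall e : R, 0 < e -> rn (l - m) < e) -> l = m.
Proof.
move=> H; apply/eqP; rewrite -subr_eq0; apply/eqP/rnorm_eq0/eqP.
rewrite eq_le rnorm_ge0 andbT; apply/ler_addgt0Pr => e /H; rewrite add0r.
exact: ltW.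
Qed.

Lemma rcvg_unique u l m : rcvg u l -> rcvg u m -> l = m.
Proof.
move=> ul um; apply: rnorm_lt0_eq => e e0; have e2 : 0 < e / 2 by lra.
have [N /(_ N (leqnn _))[]] := eventually_and (ul _ e2) (um _ e2).
by rewrite (rnormC m); have := ler_rnormB (u N) l m; lra.
Qed.

Lemma eq_rcvg u v l : (exists N, forall n, (N <= n)%N -> u n = v n) ->
  rcvg u l -> rcvg v l.
Proof.
move=> uv ul e /ul/(eventually_and uv)[N NH]; exists N => n /NH[<-//].
Qed.

Lemma rcvg_cst l : rcvg (fun=> l) l.
Proof. by move=> e e0; exists 0%N => n _; rewrite subrr rnorm0. Qed.

Lemma rcvgD u v l m : rcvg u l -> rcvg v m -> rcvg (fun n => u n + v n) (l + m).
Proof.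
move=> ul vm e e0; have e2 : 0 < e / 2 by lra.
have [N NH] := eventually_and (ul _ e2) (vm _ e2); exists N => n /NH[].
by rewrite opprD addrACA; have := rnormD (l - u n) (m - v n); lra.
Qed.

Lemma rcvg_lip (W : normedModType R[i]) (f : V -> W) (c : R) u l : 0 <= c ->
  (forall x y, rn (f x - f y) <= c * rn (x - y)) ->
  rcvg u l -> rcvg (f \o u) (f l).
Proof.
move=> c0 fc ul e e0; have c1 : 0 < c + 1 by lra.
(* Dividing by [c + 1] covers the case [c = 0]. *)
have [|N NH] := ul (e / (c + 1)); first by rewrite divr_gt0.
exists N => n /NH; rewrite ltr_pdivlMr // => H.
by apply: le_lt_trans (fc _ _) _; have := rnorm_ge0 (l - u n); nra.
Qed.

Lemma rcvgZ (a : R[i]) u l : rcvg u l -> rcvg (fun n => a *: u n) (a *: l).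
Proof.
apply: (@rcvg_lip _ (fun x => a *: x) (complex.Re `|a|)).
  by rewrite -ler0c RRe_real ?normr_real ?normr_ge0.
by move=> x y; rewrite -scalerBr rnormZ.
Qed.

Lemma rcvgN u l : rcvg u l -> rcvg (fun n => - u n) (- l).
Proof.
move=> ul; rewrite -scaleN1r.
rewrite (_ : (fun n => _) = fun n => -1 *: u n); first exact: rcvgZ.
by apply/funext => n; rewrite scaleN1r.
Qed.

Lemma rcvgB u v l m : rcvg u l -> rcvg v m -> rcvg (fun n => u n - v n) (l - m).
Proof. by move=> ul vm; apply: rcvgD => //; exact: rcvgN. Qed.

Lemma rcvg_rnorm_le u l (c : R) :
  rcvg u l ->
  (forall e : R, 0 < e -> exists N, forall n, (N <= n)%N -> rn (u n) < c + e) ->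
  rn l <= c.
Proof.
move=> ul uc; apply/ler_addgt0Pr => e e0; have e2 : 0 < e / 2 by lra.
have [N /(_ N (leqnn _))[]] := eventually_and (ul _ e2) (uc _ e2).
by have := rnormD (l - u N) (u N); rewrite subrK; lra.
Qed.

End normed.

Section cstar.
Context {A : cstarAlgType R}.
Implicit Types (u v : nat -> A) (l m : A).

Lemma rcvg_cstar u l : rcvg u l -> rcvg (fun n => cstar (u n)) (cstar l).
Proof.
apply: (@rcvg_lip _ _ (@cstar R A) 1) => // x y.
by rewrite mul1r -cstarB rnorm_star.
Qed.

Lemma rcvg_cmul u v l m :
  rcvg u l -> rcvg v m -> rcvg (fun n => u n ** v n) (l ** m).
Proof.
move=> ul vm e e0; pose c := rn l + rn m + 1.
have c0 : 0 < c by have := rnorm_ge0 l; have := rnorm_ge0 m; rewrite /c; lra.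
(* The bound [d <= 1] gives norm at most [rn m + 1] for [v n]; the two error terms then add up to at
   most [d * c]. *)
pose d := Num.min 1 (e / c / 2).
have d0 : 0 < d by rewrite lt_min ltr01 !divr_gt0.
have d1 : d <= 1 by rewrite ge_min lexx.
have dc : d * c <= e / 2.
  by rewrite -ler_pdivlMr // /d ge_min mulrAC lexx orbT.
have [N NH] := eventually_and (ul _ d0) (vm _ d0); exists N => n /NH[].
have -> : l ** m - u n ** v n = l ** (m - v n) + (l - u n) ** v n.
  by rewrite cmulBr cmulBl addrA subrK.
have := rnormD (l ** (m - v n)) ((l - u n) ** v n).
have := rnormM l (m - v n); have := rnormM (l - u n) (v n).
have := rnormD (v n - m) m; rewrite subrK (rnormC (v n)).
move: dc; rewrite /c; move: (rnorm_ge0 l) (rnorm_ge0 m) (rnorm_ge0 (l - u n)).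
move: (rnorm_ge0 (v n)) (rnorm_ge0 (m - v n)).
move: (rn l) (rn m) (rn (l - u n)) (rn (v n)) (rn (m - v n)).
move: (rn (l ** _)) (rn (_ ** v n)) (rn (_ + _)).
move=> x1 x2 x3 L M a V b b0 V0 L0 M0 a0 dc vb h1 h2 h3 ad bd.
have : L * b <= L * d by rewrite ler_wpM2l // ltW.
have : a * V <= d * (M + 1) by rewrite ler_pM //; lra.
lra.
Qed.

Lemma rcvg_morph (B : cstarAlgType R) (f : {starmorphism A -> B}) u l :
  rcvg u l -> rcvg (fun n => f (u n)) (f l).
Proof.
apply: (@rcvg_lip _ _ f 1) => // x y.
by rewrite mul1r -raddfB; exact: starmorphism_norm.
Qed.

Lemma separable_seq : separable A ->
  exists d : nat -> A, forall x (e : R), 0 < e -> exists i, rn (x - d i) < e.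
Proof.
move=> [D /countable_injP[f finj] dD].
(* [d] inverts the injection [f] on its range over [D] and takes the harmless value 0 at the other
   indices. *)
have /choice[d dE] n : exists y : A, forall x, D x -> f x = n -> y = x.
  have [[x [Dx fx]]|H] := pselect (exists x, D x /\ f x = n).
    by exists x => y Dy fy; apply: finj; rewrite ?inE // fx fy.
  by exists 0 => x Dx fx; case: H; exists x.
exists d => x e e0.
have Bx : ball x e%:C x by apply: ballxx; rewrite ltcR.
have [||y [yB Dy]] := dD (ball x e%:C).
- by exists x.
- exact: ball_open.
exists (f y); rewrite (dE _ y Dy erefl).
by move: yB; rewrite -ball_normE /ball_ /= normrE_rnorm ltcR.
Qed.

End cstar.
End Convergence.

(** * C*-algebras of bounded families *)

Record closed_subproduct (R : realType) (I : pointedType)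
    (A : I -> cstarAlgType R) := ClosedSubproduct {
  subproduct_set :> (forall i, A i) -> Prop;
  subproduct_bounded : forall a, subproduct_set a ->
    exists c, forall i, rn (a i) <= c;
  subproduct0 : subproduct_set (fun=> 0);
  subproductD : forall a b, subproduct_set a -> subproduct_set b ->
    subproduct_set (fun i => a i + b i);
  subproductZ : forall (k : R[i]) a, subproduct_set a ->
    subproduct_set (fun i => k *: a i);
  subproductM : forall a b, subproduct_set a -> subproduct_set b ->
    subproduct_set (fun i => a i ** b i);
  subproductS : forall a, subproduct_set a ->
    subproduct_set (fun i => cstar (a i));
  subproduct_closed : forall a,
    (forall e : R, 0 < e -> exists2 b, subproduct_set b &
      forall i, rn (a i - b i) <= e) ->
    subproduct_set a
}.

(** One construction serves two purposes: over [nat] it gives the bounded product of a sequence of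
    algebras, over [unit] a closed star-subalgebra of a single one. A point in [I] makes the
    supremum of the norms one over a nonempty set. *)
Record subproduct (R : realType) (I : pointedType) (A : I -> cstarAlgType R)
    (P : closed_subproduct A) := Subproduct {
  coords :> forall i, A i;
  coordsP : P coords
}.

Section SubproductAlgebra.
Context {R : realType} {I : pointedType} {A : I -> cstarAlgType R}.
Context (P : closed_subproduct A).
Local Notation Q := (subproduct P).
Implicit Types (a b c : Q).

HB.instance Definition _ := gen_eqMixin Q.
HB.instance Definition _ := gen_choiceMixin Q.

Lemma coords_inj a b : (forall i, a i = b i) -> a = b.
Proof.
case: a b => [f Pf] [g Pg] /= fg.
have {}fg : f = g by exact: functional_extensionality_dep.
by case: g / fg Pg => Pg; congr Subproduct; exact: Prop_irrelevance.
Qed.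

Definition subproduct_zero : Q := Subproduct (subproduct0 P).
Definition subproduct_add a b : Q :=
  Subproduct (subproductD (coordsP a) (coordsP b)).
Definition subproduct_scale (k : R[i]) a : Q :=
  Subproduct (subproductZ k (coordsP a)).
Definition subproduct_opp a : Q := subproduct_scale (-1) a.
Definition subproduct_mul a b : Q :=
  Subproduct (subproductM (coordsP a) (coordsP b)).
Definition subproduct_star a : Q := Subproduct (subproductS (coordsP a)).
Definition subproduct_norm a : R := sup (range (fun i => rn (a i))).

Fact subproduct_addA : associative subproduct_add.
Proof. by move=> a b c; apply: coords_inj => i /=; rewrite addrA. Qed.

Fact subproduct_addC : commutative subproduct_add.
Proof. by move=> a b; apply: coords_inj => i /=; rewrite addrC. Qed.

Fact subproduct_add0 : left_id subproduct_zero subproduct_add.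
Proof. by move=> a; apply: coords_inj => i /=; rewrite add0r. Qed.

Fact subproduct_addN : left_inverse subproduct_zero subproduct_opp subproduct_add.
Proof. by move=> a; apply: coords_inj => i /=; rewrite scaleN1r addNr. Qed.

HB.instance Definition _ := GRing.isZmodule.Build Q
  subproduct_addA subproduct_addC subproduct_add0 subproduct_addN.

Fact subproduct_scaleA k l a :
  subproduct_scale k (subproduct_scale l a) = subproduct_scale (k * l) a.
Proof. by apply: coords_inj => i /=; rewrite scalerA. Qed.

Fact subproduct_scale1 : left_id 1 subproduct_scale.
Proof. by move=> a; apply: coords_inj => i /=; rewrite scale1r. Qed.

Fact subproduct_scaleDr : right_distributive subproduct_scale +%R.
Proof. by move=> k a b; apply: coords_inj => i /=; rewrite scalerDr. Qed.

Fact subproduct_scaleDl a : {morph subproduct_scale^~ a : k l / k + l}.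
Proof. by move=> k l; apply: coords_inj => i /=; rewrite scalerDl. Qed.

HB.instance Definition _ := GRing.Zmodule_isLmodule.Build R[i] Q
  subproduct_scaleA subproduct_scale1 subproduct_scaleDr subproduct_scaleDl.

Lemma coordsD a b i : (a + b) i = a i + b i. Proof. by []. Qed.
Lemma coordsN a i : (- a) i = - a i. Proof. exact: scaleN1r. Qed.
Lemma coordsB a b i : (a - b) i = a i - b i.
Proof. by rewrite coordsD coordsN. Qed.

Lemma subproduct_norm_ub a i : rn (a i) <= subproduct_norm a.
Proof.
apply: ub_le_sup; last by exists i.
by have [c ac] := subproduct_bounded (coordsP a); exists c => _ [j _ <-].
Qed.

Lemma subproduct_norm_le a (c : R) :
  (forall i, rn (a i) <= c) -> subproduct_norm a <= c.
Proof.
by move=> ac; apply: ge_sup; [exists (rn (a point)), point|move=> _ [i _ <-]].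
Qed.

Lemma subproduct_norm_ge0 a : 0 <= subproduct_norm a.
Proof. exact: le_trans (rnorm_ge0 _) (subproduct_norm_ub a point). Qed.

Fact subproduct_normD a b :
  (subproduct_norm (a + b))%:C <= (subproduct_norm a)%:C + (subproduct_norm b)%:C.
Proof.
rewrite -rmorphD lecR; apply: subproduct_norm_le => i.
by apply: le_trans (rnormD _ _) _; apply: lerD; exact: subproduct_norm_ub.
Qed.

Fact subproduct_normZ (k : R[i]) a :
  (subproduct_norm (k *: a))%:C = `|k| * (subproduct_norm a)%:C.
Proof.
have aE (b : R[i]) : `|b| = (complex.Re `|b|)%:C by rewrite RRe_real ?normr_real.
have le (l : R[i]) b :
    subproduct_norm (l *: b) <= complex.Re `|l| * subproduct_norm b.
  apply: subproduct_norm_le => i; rewrite rnormZ.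
  apply: ler_wpM2l; last exact: subproduct_norm_ub.
  by rewrite -ler0c -aE normr_ge0.
rewrite aE -rmorphM; congr _%:C; apply/eqP; rewrite eq_le le andTb.
have [->|k0] := eqVneq k 0.
  by rewrite normr0 mul0r subproduct_norm_ge0.
have := le k^-1 (k *: a); rewrite scalerA mulVf // scale1r.
have r0 : 0 < complex.Re `|k| by rewrite -ltcR -aE normr_gt0.
rewrite (_ : complex.Re `|k^-1| = (complex.Re `|k|)^-1) ?ler_pdivlMl //.
by apply: (@complexI R); rewrite -aE fmorphV /= -aE normfV.
Qed.

Fact subproduct_norm_eq0 a : (subproduct_norm a)%:C = 0 -> a = 0.
Proof.
move=> [] a0; apply: coords_inj => i; apply: rnorm_eq0; apply/eqP.
by rewrite eq_le rnorm_ge0 andbT -a0 subproduct_norm_ub.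
Qed.

HB.instance Definition _ := Lmodule_isNormed.Build R[i] Q
  subproduct_normD subproduct_normZ subproduct_norm_eq0.

Lemma subproduct_normE a : `|a| = (subproduct_norm a)%:C.
Proof. by []. Qed.

Lemma rnorm_coords a i : rn (a i) <= rn a.
Proof. exact: subproduct_norm_ub. Qed.

(** The filter is traced by a sequence [s] that is Cauchy uniformly in the coordinates; the
    coordinatewise limit is a uniform limit, hence again a member of [P]. *)
Fact subproduct_complete (F : set_system Q) : ProperFilter F -> cauchy F -> cvg F.
Proof.
move=> FF /cauchyP Fc.
have /choice[s Fs] n : exists a : Q, F (ball a (2^-1 ^+ n : R)%:C).
  by apply: Fc; rewrite ltcR exp_half_gt0.
have ballE (q : Q) (e : R) z : ball q e%:C z -> rn (q - z) < e.
  by rewrite -ball_normE /ball_ /= normrE_rnorm ltcR.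
(* Two sets of a proper filter meet, so the two balls share a point. *)
have sc n m : rn (s n - s m) < 2^-1 ^+ n + 2^-1 ^+ m.
  have [z [/ballE z1 /ballE z2]] := filter_ex (filterI (Fs n) (Fs m)).
  by have := ler_rnormB z (s n) (s m); rewrite (rnormC z); lra.
have scl i n m : rn (s n i - s m i) < 2^-1 ^+ n + 2^-1 ^+ m.
  by rewrite -coordsB; apply: le_lt_trans (rnorm_coords _ _) (sc n m).
have lim i : {l | rcvg (fun n => s n i) l}.
  apply: cid; apply: rcauchy_rcvg => e e0; have e2 : 0 < e / 2 by lra.
  have [N NH] := exp_half_lt e2; exists N => n m /NH n2 /NH m2.
  by have := scl i n m; lra.
pose l i := sval (lim i).
have ls n i : rn (l i - s n i) <= 2^-1 ^+ n.
  apply: rcvg_rnorm_le (rcvgB (svalP (lim i)) (rcvg_cst _)) _ => e.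
  move=> /exp_half_lt[N NH].
  by exists N => m /NH; have := scl i m n; lra.
have Pl : P l.
  apply: subproduct_closed => e /exp_half_lt[N /(_ N (leqnn _)) Ne].
  by exists (s N); [exact: coordsP|move=> i; apply: le_trans (ls N i) (ltW Ne)].
apply/cvg_ex; exists (Subproduct Pl); apply/cvgrPdist_lt => e e0.
have eE : e = (complex.Re e)%:C by rewrite RRe_real // gtr0_real.
set f := complex.Re e in eE; have f0 : 0 < f by rewrite -ltcR -eE.
have [|N /(_ N (leqnn _)) Nf] := @exp_half_lt R (f / 2); first by lra.
apply: filterS (Fs N) => z /ballE sz.
rewrite eE normrE_rnorm ltcR.
apply: le_lt_trans (ler_rnormB (s N) _ _) _.
have : rn (Subproduct Pl - s N) <= 2^-1 ^+ N.
  by apply: subproduct_norm_le => i; rewrite coordsB; exact: ls.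
by lra.
Qed.

HB.instance Definition _ := Uniform_isComplete.Build Q subproduct_complete.

Local Notation mul := subproduct_mul.
Local Notation star := subproduct_star.

Fact subproduct_mulA : associative mul.
Proof. by move=> a b c; apply: coords_inj => i /=; rewrite cmulA. Qed.

Fact subproduct_mulDl : left_distributive mul +%R.
Proof. by move=> a b c; apply: coords_inj => i /=; rewrite cmulDl. Qed.

Fact subproduct_mulDr : right_distributive mul +%R.
Proof. by move=> a b c; apply: coords_inj => i /=; rewrite cmulDr. Qed.

Fact subproduct_scaleAl (k : R[i]) a b : k *: mul a b = mul (k *: a) b.
Proof. by apply: coords_inj => i /=; rewrite cscaleAl. Qed.

Fact subproduct_scaleAr (k : R[i]) a b : k *: mul a b = mul a (k *: b).
Proof. by apply: coords_inj => i /=; rewrite cscaleAr. Qed.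

Fact subproduct_starK : involutive star.
Proof. by move=> a; apply: coords_inj => i /=; rewrite cstarK. Qed.

Fact subproduct_starD : {morph star : a b / a + b}.
Proof. by move=> a b; apply: coords_inj => i /=; rewrite cstarD. Qed.

Fact subproduct_starZ (k : R[i]) a : star (k *: a) = conjc k *: star a.
Proof. by apply: coords_inj => i /=; rewrite cstarZ. Qed.

Fact subproduct_starM a b : star (mul a b) = mul (star b) (star a).
Proof. by apply: coords_inj => i /=; rewrite cstarM. Qed.

Fact subproduct_normM a b : `|mul a b| <= `|a| * `|b|.
Proof.
rewrite !subproduct_normE -rmorphM lecR; apply: subproduct_norm_le => i.
apply: le_trans (rnormM _ _) _.
by apply: ler_pM; rewrite ?rnorm_ge0 ?subproduct_norm_ub.
Qed.

Fact subproduct_norm_star a : `|mul (star a) a| = `|a| ^+ 2.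
Proof.
rewrite !subproduct_normE -rmorphXn; congr _%:C; apply/eqP; rewrite eq_le.
apply/andP; split.
  apply: subproduct_norm_le => i; rewrite /= rnorm_starM.
  by rewrite ler_sqr ?nnegrE ?rnorm_ge0 ?subproduct_norm_ge0 ?subproduct_norm_ub.
(* The square root of [c] bounds every coordinate of [a], by the C*-identity in each factor, and
   hence also their supremum. *)
set c := subproduct_norm (mul _ _); have c0 : 0 <= c := subproduct_norm_ge0 _.
rewrite -(sqr_sqrtr c0) ler_sqr ?nnegrE ?sqrtr_ge0 ?subproduct_norm_ge0 //.
apply: subproduct_norm_le => i.
rewrite -(@ler_sqr _ (rn (a i))) ?nnegrE ?sqrtr_ge0 ?rnorm_ge0 //.
by rewrite sqr_sqrtr // -rnorm_starM; exact: (subproduct_norm_ub (mul (star a) a)).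
Qed.

HB.instance Definition _ := isCStarAlgebra.Build R Q
  subproduct_mulA subproduct_mulDl subproduct_mulDr
  subproduct_scaleAl subproduct_scaleAr
  subproduct_starK subproduct_starD subproduct_starZ subproduct_starM
  subproduct_normM subproduct_norm_star.

Definition component (i : I) : Q -> A i := fun a => a i.

Fact component_linear i : linear (component i).
Proof. by []. Qed.

HB.instance Definition _ i := GRing.isLinear.Build R[i] Q (A i) _ (component i)
  (component_linear i).

Fact componentM i : {morph component i : a b / a ** b}.
Proof. by []. Qed.

Fact componentS i : {morph component i : a / cstar a}.
Proof. by []. Qed.

HB.instance Definition _ i :=
  isStarMorphism.Build R Q (A i) (component i) (componentM i) (componentS i).

Section Pairing.
Context (C : cstarAlgType R) (f : forall i, {starmorphism C -> A i}).
Context (fP : forall x, P (fun i => f i x)).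

Definition pairing (x : C) : Q := Subproduct (fP x).

Fact pairing_linear : linear pairing.
Proof. by move=> k x y; apply: coords_inj => i /=; rewrite linearP. Qed.

HB.instance Definition _ := GRing.isLinear.Build R[i] C Q _ pairing pairing_linear.

Fact pairingM : {morph pairing : x y / x ** y}.
Proof. by move=> x y; apply: coords_inj => i /=; rewrite starmM. Qed.

Fact pairingS : {morph pairing : x / cstar x}.
Proof. by move=> x; apply: coords_inj => i /=; rewrite starmS. Qed.

HB.instance Definition _ := isStarMorphism.Build R C Q pairing pairingM pairingS.

End Pairing.

End SubproductAlgebra.

(** * Identity, composite and zero morphisms *)

Section StarMorphisms.
Context {R : realType}.
Implicit Types A B C : cstarAlgType R.

Section id.
Context {A}.
Fact idM : {morph (@idfun A) : x y / x ** y}. Proof. by []. Qed.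
Fact idS : {morph (@idfun A) : x / cstar x}. Proof. by []. Qed.
HB.instance Definition _ := isStarMorphism.Build R A A idfun idM idS.
End id.

Section comp.
Context {A B C} (f : {starmorphism A -> B}) (g : {starmorphism B -> C}).
Fact compM : {morph g \o f : x y / x ** y}.
Proof. by move=> x y; rewrite /= !starmM. Qed.
Fact compS : {morph g \o f : x / cstar x}.
Proof. by move=> x; rewrite /= !starmS. Qed.
HB.instance Definition _ := isStarMorphism.Build R A C (g \o f) compM compS.
End comp.

Section zero.
Context {A B}.
Definition zero_morphism (x : A) : B := 0.
Fact zero_linear : linear zero_morphism.
Proof. by move=> k x y; rewrite /zero_morphism scaler0 addr0. Qed.
Fact zeroM : {morph zero_morphism : x y / x ** y}.
Proof. by move=> x y; rewrite /zero_morphism cmul0l. Qed.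
Fact zeroS : {morph zero_morphism : x / cstar x}.
Proof. by move=> x; rewrite /zero_morphism cstar0. Qed.
HB.instance Definition _ := GRing.isLinear.Build R[i] A B _
  zero_morphism zero_linear.
HB.instance Definition _ := isStarMorphism.Build R A B zero_morphism zeroM zeroS.
End zero.

End StarMorphisms.

(** * Composite connecting morphisms of a sequential system *)

Section Transition.
Context {R : realType}.

(* Recursing on both indices, with the system shifted by one, avoids casting
   [C n] along equations between indices; the value is 0 when [m < n]. *)
Fixpoint transition0 (C : nat -> cstarAlgType R)
    (phi : forall n, {starmorphism C n -> C n.+1}) m : {starmorphism C 0 -> C m} :=
  if m is m'.+1 then phi m' \o transition0 phi m' else idfun.

Fixpoint transition n (C : nat -> cstarAlgType R)
    (phi : forall n, {starmorphism C n -> C n.+1}) m : {starmorphism C n -> C m} :=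
  match n, m with
  | 0, _ => transition0 phi m
  | n'.+1, 0 => @zero_morphism R (C n'.+1) (C 0)
  | n'.+1, m'.+1 => transition n' (fun k => phi k.+1) m'
  end.

Lemma transition_id n (C : nat -> cstarAlgType R)
    (phi : forall n, {starmorphism C n -> C n.+1}) x : transition n phi n x = x.
Proof. by elim: n C phi x => [//|n IH] C phi x /=; exact: IH. Qed.

Lemma transitionS n (C : nat -> cstarAlgType R)
    (phi : forall n, {starmorphism C n -> C n.+1}) m x : (n <= m)%N ->
  transition n phi m.+1 x = phi m (transition n phi m x).
Proof.
elim: n C phi m x => [//|n IH] C phi [//|m] x nm.
exact: (IH _ (fun k => phi k.+1) m x nm).
Qed.

Context {C : nat -> cstarAlgType R} {phi : forall n, {starmorphism C n -> C n.+1}}.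

Lemma transition_trans i j k x : (i <= j)%N -> (j <= k)%N ->
  transition j phi k (transition i phi j x) = transition i phi k x.
Proof.
move=> ij; elim: k => [|k IH].
  by rewrite leqn0 => /eqP j0; case: _ / (esym j0); rewrite transition_id.
rewrite leq_eqVlt => /predU1P[<-|jk]; first by rewrite transition_id.
by rewrite !transitionS ?IH // (leq_trans ij).
Qed.

Lemma transition_phi n m x : (n < m)%N ->
  transition n.+1 phi m (phi n x) = transition n phi m x.
Proof.
move=> nm; rewrite -[in RHS](@transition_trans _ n.+1) //.
by rewrite transitionS // transition_id.
Qed.

Lemma cocone_transition A (alpha : forall n, {starmorphism C n -> A}) n m x :
  is_cocone phi alpha -> (n <= m)%N -> alpha m (transition n phi m x) = alpha n x.
Proof.
move=> co; elim: m => [|m IH].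
  by rewrite leqn0 => /eqP n0; case: _ / (esym n0) x => x; rewrite transition_id.
rewrite leq_eqVlt => /predU1P[<-|nm]; first by rewrite transition_id.
by rewrite transitionS // co IH.
Qed.

End Transition.

(** * Density of the union of the images in an inductive limit *)

Section ImagesDense.
Context {R : realType} {C : nat -> cstarAlgType R}.
Context {phi : forall n, {starmorphism C n -> C n.+1}} {A : cstarAlgType R}.
Context {alpha : forall n, {starmorphism C n -> A}}.

Hypothesis co : is_cocone phi alpha.

Definition near_images (a : A) := forall e : R, 0 < e ->
  exists n x, rn (a - alpha n x) < e.

Lemma near_imagesP a : near_images a -> forall e : R, 0 < e ->
  exists N, forall n, (N <= n)%N -> exists x, rn (a - alpha n x) < e.
Proof.
move=> aP e /aP[N [x xe]]; exists N => n Nn; exists (transition N phi n x).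
by rewrite cocone_transition.
Qed.

(** At stage [n] a single [x n] is chosen that attains each accuracy [2^-1 ^+ j], [j < n],
    attainable there. Two points then have approximants at common stages, which reduces closure
    under the operations to limit laws. *)
Lemma near_images_seq a : near_images a ->
  exists x : forall n, C n, rcvg (fun n => alpha n (x n)) (a).
Proof.
move=> aP.
have best n k : exists x, forall j, (j < k)%N ->
    (exists y, rn (a - alpha n y) < 2^-1 ^+ j) ->
    rn (a - alpha n x) < 2^-1 ^+ j.
  elim: k => [|k [x IH]]; first by exists 0.
  have [[y yk]|H] := pselect (exists y, rn (a - alpha n y) < 2^-1 ^+ k).
    (* A witness of the finest accuracy serves all coarser ones. *)
    exists y => j; rewrite ltnS => jk _; apply: lt_le_trans yk _.
    by rewrite ler_wiXn2l //; lra.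
  by exists x => j; rewrite ltnS leq_eqVlt => /predU1P[->//|]; exact: IH.
pose x n := sval (cid (best n n)).
exists x => e e0.
have [M /(_ M (leqnn _)) Me] := exp_half_lt e0.
have [N NH] := near_imagesP aP (exp_half_gt0 M).
(* [M < n] puts the accuracy [2^-1 ^+ M] among those that [x n] takes into account. *)
exists (maxn N M.+1) => n; rewrite geq_max => /andP[/NH Nn Mn].
by apply: lt_trans Me; exact: (svalP (cid (best n n))).
Qed.

Lemma seq_near_images (a : A) (x : forall n, C n) :
  rcvg (fun n => alpha n (x n)) (a) -> near_images a.
Proof. by move=> ax e /ax[N NH]; exists N, (x N); exact: NH. Qed.

Fact near_images_bounded (a : unit -> A) : near_images (a tt) ->
  exists c, forall i, rn (a i) <= c.
Proof. by exists (rn (a tt)) => -[]. Qed.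

Fact near_images0 : near_images 0.
Proof.
by apply: (@seq_near_images _ (fun=> 0)) => e e0; exists 0%N => n _;
   rewrite raddf0 subr0 rnorm0.
Qed.

Fact near_imagesD a b : near_images a -> near_images b -> near_images (a + b).
Proof.
move=> /near_images_seq[x xa] /near_images_seq[y yb].
apply: (@seq_near_images _ (fun n => x n + y n)).
by under eq_fun do rewrite raddfD; exact: rcvgD.
Qed.

Fact near_imagesZ k a : near_images a -> near_images (k *: a).
Proof.
move=> /near_images_seq[x xa]; apply: (@seq_near_images _ (fun n => k *: x n)).
by under eq_fun do rewrite linearZ; exact: rcvgZ.
Qed.

Fact near_imagesM a b : near_images a -> near_images b -> near_images (a ** b).
Proof.
move=> /near_images_seq[x xa] /near_images_seq[y yb].
apply: (@seq_near_images _ (fun n => x n ** y n)).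
by under eq_fun do rewrite starmM; exact: rcvg_cmul.
Qed.

Fact near_imagesS a : near_images a -> near_images (cstar a).
Proof.
move=> /near_images_seq[x xa]; apply: (@seq_near_images _ (fun n => cstar (x n))).
by under eq_fun do rewrite starmS; exact: rcvg_cstar.
Qed.

Fact near_images_closed (a : unit -> A) :
  (forall e : R, 0 < e -> exists2 b : unit -> A, near_images (b tt) &
    forall i, rn (a i - b i) <= e) -> near_images (a tt).
Proof.
move=> H e e0; have e2 : 0 < e / 2 by lra.
have [b /(_ _ e2)[n [x bx]] /(_ tt) ab] := H _ e2; exists n, x.
by have := ler_rnormB (b tt) (a tt) (alpha n x); lra.
Qed.

(** The closure of the union of the images, a closed star-subalgebra of [A], as families over a
    one-point index. *)
Definition near_images_subalgebra : closed_subproduct (fun _ : unit => A) :=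
  @ClosedSubproduct R unit (fun=> A) (fun a => near_images (a tt))
    near_images_bounded near_images0 (fun a b => @near_imagesD (a tt) (b tt))
    (fun k a => @near_imagesZ k (a tt)) (fun a b => @near_imagesM (a tt) (b tt))
    (fun a => @near_imagesS (a tt)) near_images_closed.

Fact near_images_image n x : near_images (alpha n x).
Proof. by move=> e e0; exists n, x; rewrite subrr rnorm0. Qed.

Definition to_near_images n :
    {starmorphism C n -> subproduct near_images_subalgebra} :=
  pairing (fun x =>
    @near_images_image n x : near_images_subalgebra (fun=> alpha n x)).

End ImagesDense.

(* The inclusion of the closure of the union of the images splits, by the
   universal property. *)
Lemma inductive_limit_dense (R : realType) (C : nat -> cstarAlgType R)
    (phi : forall n, {starmorphism C n -> C n.+1}) (A : cstarAlgType R)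
    (alpha : forall n, {starmorphism C n -> A}) :
  is_inductive_limit phi alpha -> forall a (e : R), 0 < e ->
  exists N, forall n, (N <= n)%N -> exists x, rn (a - alpha n x) < e.
Proof.
move=> [co univ] a; apply: near_imagesP => //.
have [|f [fE _]] := univ _ (to_near_images co).
  by move=> n x; apply: coords_inj => -[]; exact: co.
have [g [_ gU]] := univ _ alpha co.
(* The inclusion after [f] and the identity both carry [alpha] to [alpha], so uniqueness makes both
   equal to [g]. *)
have <- : component tt (f a) = a.
  pose h : {starmorphism A -> A} := component tt \o f.
  transitivity (g a); first by apply: (gU h) => n x; rewrite /h /= fE.
  by symmetry; apply: (gU idfun).
exact: (coordsP (f a)).
Qed.

(** * The bounded product, its ideals and their quotients *)

Section BoundedProduct.
Context {R : realType} (B : nat -> cstarAlgType R).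

Definition bounded_family (b : forall n, B n) := exists c, forall n, rn (b n) <= c.

Fact bounded_family0 : bounded_family (fun=> 0).
Proof. by exists 0 => n; rewrite rnorm0. Qed.

Fact bounded_familyD a b : bounded_family a -> bounded_family b ->
  bounded_family (fun n => a n + b n).
Proof.
move=> [c ac] [d bd]; exists (c + d) => n.
by apply: le_trans (rnormD _ _) _; exact: lerD.
Qed.

Fact bounded_familyZ k a : bounded_family a -> bounded_family (fun n => k *: a n).
Proof.
move=> [c ac]; exists (complex.Re `|k| * c) => n; rewrite rnormZ ler_wpM2l //.
by rewrite -ler0c RRe_real ?normr_real ?normr_ge0.
Qed.

Fact bounded_familyM a b : bounded_family a -> bounded_family b ->
  bounded_family (fun n => a n ** b n).
Proof.
move=> [c ac] [d bd]; exists (c * d) => n.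
by apply: le_trans (rnormM _ _) _; rewrite ler_pM ?rnorm_ge0.
Qed.

Fact bounded_familyS a : bounded_family a -> bounded_family (fun n => cstar (a n)).
Proof. by move=> [c ac]; exists c => n; rewrite rnorm_star. Qed.

Fact bounded_family_closed a :
  (forall e : R, 0 < e -> exists2 b, bounded_family b &
    forall n, rn (a n - b n) <= e) -> bounded_family a.
Proof.
move=> /(_ 1 ltr01)[b [c bc] ab]; exists (1 + c) => n.
by rewrite -(subrK (b n) (a n)); apply: le_trans (rnormD _ _) _; exact: lerD.
Qed.

Definition bounded_product : closed_subproduct B :=
  @ClosedSubproduct R nat B bounded_family (fun=> id) bounded_family0
    bounded_familyD bounded_familyZ bounded_familyM bounded_familyS
    bounded_family_closed.

Local Notation T := (subproduct bounded_product).

Definition vanishing_from k (b : T) : Prop := forall n, (k <= n)%N -> b n = 0.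

Fact vanishing_from0 k : vanishing_from k 0.
Proof. by []. Qed.

Fact vanishing_fromD k a b : vanishing_from k a -> vanishing_from k b ->
  vanishing_from k (a + b).
Proof. by move=> ak bk n kn; rewrite coordsD ak // bk // addr0. Qed.

Fact vanishing_fromZ k (c : R[i]) a : vanishing_from k a ->
  vanishing_from k (c *: a).
Proof. by move=> ak n kn /=; rewrite ak // scaler0. Qed.

Fact vanishing_fromMl k a b : vanishing_from k b -> vanishing_from k (a ** b).
Proof. by move=> bk n kn /=; rewrite bk // cmul0r. Qed.

Fact vanishing_fromMr k a b : vanishing_from k b -> vanishing_from k (b ** a).
Proof. by move=> bk n kn /=; rewrite bk // cmul0l. Qed.

Fact vanishing_from_closed k : closed (vanishing_from k).
Proof.
move=> b /closure_rnorm bk n kn; apply: rnorm_lt0_eq => e /bk[a ak].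
by apply: le_lt_trans; rewrite -(ak n kn) -coordsB; exact: rnorm_coords.
Qed.

Definition vanishing_ideal k : closed_ideal T :=
  ClosedIdeal (@vanishing_from0 k) (@vanishing_fromD k) (@vanishing_fromZ k)
    (@vanishing_fromMl k) (@vanishing_fromMr k) (@vanishing_from_closed k).

Lemma vanishing_ideal_incr k : vanishing_ideal k `<=` vanishing_ideal k.+1.
Proof. by move=> b bk n /ltnW; exact: bk. Qed.

Local Notation J := vanishing_ideal.
Local Notation Jlim := (ideal_lim vanishing_ideal_incr).

(** For [k <= n] the coordinate does not depend on the representative, as [J k] vanishes there; the
    value 0 elsewhere keeps the map a morphism for all [n]. *)
Definition quotient_component k n (q : quotient (J k)) : B n :=
  if (k <= n)%N then repr q n else 0.

Lemma quotient_componentE k n b : (k <= n)%N ->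
  quotient_component n (quotient_pi (J k) b) = b n.
Proof.
move=> kn; rewrite /quotient_component kn; apply/eqP; rewrite -subr_eq0 -coordsB.
by apply/eqP; exact: (@quotient_pi_repr _ _ (J k) b n kn).
Qed.

Lemma quotient_component_out k n q : (n < k)%N ->
  @quotient_component k n q = 0.
Proof. by move=> nk; rewrite /quotient_component leqNgt nk. Qed.

Fact quotient_component_linear k n : linear (@quotient_component k n).
Proof.
move=> c p q; case: (leqP k n) => kn; last first.
  by rewrite !quotient_component_out // scaler0 addr0.
rewrite -[p]quotient_reprK -[q]quotient_reprK -(linearP (quotient_pi _)).
by rewrite !quotient_componentE.
Qed.

Fact quotient_componentM k n : {morph @quotient_component k n : p q / p ** q}.
Proof.
move=> p q; case: (leqP k n) => kn; last first.
  by rewrite !quotient_component_out // cmul0r.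
rewrite -[p]quotient_reprK -[q]quotient_reprK -starmM.
by rewrite !quotient_componentE.
Qed.

Fact quotient_componentS k n : {morph @quotient_component k n : p / cstar p}.
Proof.
move=> p; case: (leqP k n) => kn; last first.
  by rewrite !quotient_component_out // cstar0.
by rewrite -[p]quotient_reprK -starmS !quotient_componentE.
Qed.

HB.instance Definition _ k n := GRing.isLinear.Build R[i] (quotient (J k)) (B n) _
  (@quotient_component k n) (@quotient_component_linear k n).

HB.instance Definition _ k n := isStarMorphism.Build R (quotient (J k)) (B n)
  (@quotient_component k n) (@quotient_componentM k n) (@quotient_componentS k n).

(* The quotient by the limit ideal is [prod / c_0], with norm the limsup. *)
Lemma quotient_lim_norm (b : T) (c : R) : rn (quotient_pi Jlim b) < c ->
  exists N, forall n, (N <= n)%N -> rn (b n) < c.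
Proof.
(* Some lift [a] of the class has norm below [c]; [b - a] lies within [c - rn a] of a sequence [j]
   that vanishes from some [N] on. *)
move=> /quotient_norm_lt[a /esym/quotient_piP ab ac].
have c0 : 0 < c - rn a by rewrite subr_gt0.
have [j [N _ jN] H] := closure_rnorm ab c0; exists N => n Nn.
have := rnorm_coords a n; have := rnorm_coords (b - a - j) n.
rewrite !coordsB (jN n Nn) subr0.
by have := rnormD (b n - a n) (a n); rewrite subrK; lra.
Qed.

End BoundedProduct.

(** * Approximate lifting of morphisms along an inductive system *)

Section ApproximateLifting.
Context {R : realType} {B : nat -> cstarAlgType R}.
Context {phi : forall n, {starmorphism B n -> B n.+1}} {A : cstarAlgType R}.
Context {beta : forall n, {starmorphism B n -> A}}.

Local Notation T := (subproduct (bounded_product B)).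
Local Notation Jlim := (ideal_lim (@vanishing_ideal_incr R B)).

Fact transition_bounded n x : bounded_product B (fun m => transition n phi m x).
Proof. by exists (rn x) => m; exact: starmorphism_norm. Qed.

Definition trajectory n : {starmorphism B n -> T} :=
  pairing (@transition_bounded n).

(** The trajectories of [x] and [phi n x] agree from [n.+1] on, so they differ by an element of an
    ideal of the sequence. *)
Lemma trajectory_cocone :
  is_cocone phi (fun n => quotient_pi Jlim \o trajectory n).
Proof.
move=> n x; apply/quotient_piP/subset_closure; exists n.+1 => // m nm.
by rewrite coordsB /= transition_phi // subrr.
Qed.

(** The trajectories induce [f] from [A] to the quotient by the limit ideal. Weak semiprojectivity
    lifts [f \o gamma] approximately to the quotient by some [vanishing_ideal k], whose coordinates
    beyond [k] are morphisms into the [B n]. *)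
Lemma approximate_lift (C : cstarAlgType R) (gamma : {starmorphism C -> A})
    (d : nat -> C) p (e : R) :
  is_inductive_limit phi beta -> weakly_semiprojective C -> 0 < e ->
  exists N, forall n, (N <= n)%N -> exists psi : {starmorphism C -> B n},
    forall i, (i < p)%N -> rn (beta n (psi (d i)) - gamma (d i)) < e /\
                           rn (psi (d i)) < rn (gamma (d i)) + e.
Proof.
move=> lim Cwsp e0; have e4 : 0 < e / 4 by lra.
have [f [fE _]] := lim.2 _ _ trajectory_cocone.
pose F := [set d i | i in `I_p].
have [|k [psi psiE]] := Cwsp _ _ _ (f \o gamma) (e / 4) F e4.
  exact/finite_image/finite_II.
(* By definition [quotient_map] takes the class of a representative, so the estimate concerns the
   concrete sequence [repr (psi (d i))]. *)
have {}psiE i : (i < p)%N ->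
    rn (quotient_pi Jlim (repr (psi (d i))) - f (gamma (d i))) < e / 4.
  by move=> ip; rewrite -ltcR -normrE_rnorm; apply: psiE; exists i.
have [N NH] : exists N, forall n, (N <= n)%N -> forall i, (i < p)%N ->
    rn (beta n (repr (psi (d i)) n) - gamma (d i)) < e /\
    rn (repr (psi (d i)) n) < rn (gamma (d i)) + e.
  apply: eventually_ltn => i /psiE; set t := repr _ => ti; apply: eventually_and.
    (* Since [f] sends [beta M b] to the class of the trajectory of [b], that trajectory is
       eventually within [e / 2] of [t]; applying [beta n] brings [beta n (t n)] close to
       [beta M b], hence to [gamma (d i)]. *)
    have [M /(_ M (leqnn _))[b bE]] := inductive_limit_dense lim (gamma (d i)) e4.
    have [|N NH] := @quotient_lim_norm _ _ (t - trajectory M b) (e / 2).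
      rewrite raddfB /=.
      have := fE M b; rewrite /= => <-.
      have := starmorphism_norm f (gamma (d i) - beta M b); rewrite raddfB.
      set u := quotient_pi Jlim t in ti *; set v := f (gamma _) in ti *.
      by have := ler_rnormB v u (f (beta M b)); lra.
    exists (maxn M N) => n; rewrite geq_max => /andP[Mn /NH].
    rewrite coordsB /= => H.
    have := starmorphism_norm (beta n) (t n - transition M phi n b).
    rewrite raddfB /= (cocone_transition b lim.1) //.
    by have := ler_rnormB (beta M b) (beta n (t n)) (gamma (d i));
       rewrite (rnormC (beta M b)); lra.
  (* The norm bound: the class of [t] is [e / 4]-close to [f (gamma (d i))], and [f] is
     contractive. *)
  apply: quotient_lim_norm.
  have := starmorphism_norm f (gamma (d i)).
  have := rnormD (quotient_pi Jlim t - f (gamma (d i))) (f (gamma (d i))).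
  by rewrite subrK; lra.
exists (maxn N k) => n; rewrite geq_max => /andP[/NH Nn kn].
exists (quotient_component n \o psi) => i /Nn.
by rewrite /= /quotient_component kn.
Qed.

End ApproximateLifting.

(** * Pointwise limits of morphisms *)

Section MakeStarMorphism.
Context {R : realType} {A B : cstarAlgType R} (f : A -> B).
Context (fL : linear f) (fM : {morph f : x y / x ** y}).
Context (fS : {morph f : x / cstar x}).

Let g := f.
HB.instance Definition _ := GRing.isLinear.Build R[i] A B _ g fL.
HB.instance Definition _ := isStarMorphism.Build R A B g fM fS.

Definition make_starmorphism : {starmorphism A -> B} := g.

End MakeStarMorphism.

Lemma rcvg_starmorphism (R : realType) (A B : cstarAlgType R)
    (f : nat -> {starmorphism A -> B}) :
  (forall x, rcauchy (fun n => f n x)) ->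
  exists g : {starmorphism A -> B}, forall x, rcvg (fun n => f n x) (g x).
Proof.
move=> fc; have /choice[g gP] x := rcauchy_rcvg (fc x).
have gL : linear g.
  move=> k x y; apply: rcvg_unique (gP _) _.
  under eq_fun do rewrite linearP.
  by apply: rcvgD; [apply: rcvgZ|]; exact: gP.
have gM : {morph g : x y / x ** y}.
  move=> x y; apply: rcvg_unique (gP _) _.
  by under eq_fun do rewrite starmM; exact: rcvg_cmul.
have gS : {morph g : x / cstar x}.
  move=> x; apply: rcvg_unique (gP _) _.
  by under eq_fun do rewrite starmS; exact: rcvg_cstar.
by exists (make_starmorphism gL gM gS); exact: gP.
Qed.

(** * A metric criterion for inductive limits *)

Section InductiveLimitCriterion.
Context {R : realType} {C : nat -> cstarAlgType R}.
Context {phi : forall n, {starmorphism C n -> C n.+1}} {A : cstarAlgType R}.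
Context {alpha : forall n, {starmorphism C n -> A}}.

Hypothesis co : is_cocone phi alpha.
Hypothesis alpha_dense : forall a (e : R), 0 < e ->
  exists n x, rn (a - alpha n x) < e.
Hypothesis alpha_norm : forall n x (e : R), 0 < e ->
  exists N, forall m, (N <= m)%N -> rn (transition n phi m x) < rn (alpha n x) + e.

(** [beta n x] is also the image of [x] transported to a late stage, where its norm is almost at
    most that of [alpha n x]. This domination makes every cocone factor through [alpha]. *)
Lemma cocone_norm (B : cstarAlgType R) (beta : forall n, {starmorphism C n -> B})
    n x : is_cocone phi beta -> rn (beta n x) <= rn (alpha n x).
Proof.
move=> bco; apply/ler_addgt0Pr => e /(alpha_norm x)[N NH].
have := NH _ (leq_maxr n N); have := leq_maxl n N; set m := maxn n N => nm.
have := starmorphism_norm (beta m) (transition n phi m x).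
by rewrite (cocone_transition x bco nm); lra.
Qed.

Lemma cocone_normB (B : cstarAlgType R) (beta : forall n, {starmorphism C n -> B})
    n m x y : is_cocone phi beta ->
  rn (beta n x - beta m y) <= rn (alpha n x - alpha m y).
Proof.
move=> bco; pose k := maxn n m.
rewrite -(cocone_transition x bco (leq_maxl n m)).
rewrite -(cocone_transition y bco (leq_maxr n m)).
rewrite -(cocone_transition x co (leq_maxl n m)).
rewrite -(cocone_transition y co (leq_maxr n m)).
by rewrite -!raddfB; exact: cocone_norm bco.
Qed.

Lemma inductive_limit_criterion : is_inductive_limit phi alpha.
Proof.
split=> // B beta bco.
have seqA a := near_images_seq co (alpha_dense a).
(* The value [b] is required to work for every sequence approximating [a], so that [f] can later be
   computed on sums, products and adjoints of chosen sequences. *)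
have /choice[f fP] a : exists b, forall x : forall n, C n,
    rcvg (fun n => alpha n (x n)) a -> rcvg (fun n => beta n (x n)) b.
  have [x xa] := seqA a.
  have [|b xb] := @rcauchy_rcvg _ _ (fun n => beta n (x n)).
    move=> e e0; have e2 : 0 < e / 2 by lra.
    have [N NH] := xa _ e2; exists N => n m /NH n2 /NH m2.
    apply: le_lt_trans (cocone_normB _ _ bco) _.
    by have := ler_rnormB a (alpha n (x n)) (alpha m (x m));
       rewrite (rnormC _ a); lra.
  (* The difference of two approximating sequences is null under [alpha], hence under [beta] by
     domination. *)
  exists b => y ya; rewrite -[b]addr0.
  rewrite (_ : (fun n => beta n (y n)) =
    fun n => beta n (x n) + beta n (y n - x n)); last first.
    by apply/funext => n; rewrite raddfB addrC subrK.
  apply: rcvgD => // e /(rcvgB ya xa)[N NH]; exists N => n /NH.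
  rewrite subrr !sub0r !rnormN -raddfB; apply: le_lt_trans.
  exact: cocone_norm bco.
have fE n x : f (alpha n x) = beta n x.
  (* The trajectory of [x] approximates [alpha n x]: under any cocone it is constant from stage [n]
     on. *)
  have tr (D : cstarAlgType R) (delta : forall n, {starmorphism C n -> D}) :
      is_cocone phi delta ->
      rcvg (fun m => delta m (transition n phi m x)) (delta n x).
    move=> dco; apply: eq_rcvg (rcvg_cst _); exists n => m nm.
    by rewrite cocone_transition.
  exact: rcvg_unique (fP _ _ (tr _ _ co)) (tr _ _ bco).
have fL : linear f.
  move=> k a b; have [x xa] := seqA a; have [y yb] := seqA b.
  apply: (@rcvg_unique _ _ (fun n => beta n (k *: x n + y n))).
    apply: fP; under eq_fun do rewrite linearP.
    by apply: rcvgD => //; exact: rcvgZ.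
  under eq_fun do rewrite linearP.
  by apply: rcvgD; [apply: rcvgZ|]; exact: fP.
have fM : {morph f : x y / x ** y}.
  move=> a b; have [x xa] := seqA a; have [y yb] := seqA b.
  apply: (@rcvg_unique _ _ (fun n => beta n (x n ** y n))).
    by apply: fP; under eq_fun do rewrite starmM; exact: rcvg_cmul.
  by under eq_fun do rewrite starmM; apply: rcvg_cmul; exact: fP.
have fS : {morph f : x / cstar x}.
  move=> a; have [x xa] := seqA a.
  apply: (@rcvg_unique _ _ (fun n => beta n (cstar (x n)))).
    by apply: fP; under eq_fun do rewrite starmS; exact: rcvg_cstar.
  by under eq_fun do rewrite starmS; apply: rcvg_cstar; exact: fP.
exists (make_starmorphism fL fM fS); split=> // g gE a.
have [x xa] := seqA a; apply: rcvg_unique (fP _ _ xa).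
by under eq_fun do rewrite -gE; exact: rcvg_morph.
Qed.

End InductiveLimitCriterion.

(** * From an approximately commuting system to an exact inductive limit *)

Section ApproximateIntertwining.
Context {R : realType} {C : nat -> cstarAlgType R}.
Context {phi : forall n, {starmorphism C n -> C n.+1}} {A : cstarAlgType R}.
Context {delta : forall n, {starmorphism C n -> A}}.
Context {d : forall n, nat -> C n} {a : nat -> A}.

Hypothesis d_dense : forall n x (e : R), 0 < e -> exists i, rn (x - d n i) < e.
Hypothesis a_dense : forall x (e : R), 0 < e -> exists i, rn (x - a i) < e.
Hypothesis d_double : forall n j, d n.+1 j.*2 = phi n (d n j).
Hypothesis delta_phi : forall n i, (i < n.+1 * 2 ^ n)%N ->
  rn (delta n.+1 (phi n (d n i)) - delta n (d n i)) < 2^-1 ^+ n.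
Hypothesis phi_norm : forall n i, (i < n.+1 * 2 ^ n)%N ->
  rn (phi n (d n i)) < rn (delta n (d n i)) + 2^-1 ^+ n.
Hypothesis delta_a : forall n j, (j <= n)%N ->
  rn (a j - delta n.+1 (d n.+1 j.*2.+1)) < 2^-1 ^+ n.

Local Notation tr := (fun n m => transition n phi m).

Lemma transition_dense_seq n m j : (n <= m)%N ->
  tr n m (d n j) = d m (2 ^ (m - n) * j).
Proof.
move=> nm; rewrite -(subnKC nm) addKn; elim: (m - n)%N => [|k IH].
  by rewrite addn0 transition_id mul1n.
rewrite addnS transitionS ?leq_addr // IH -d_double.
by rewrite expnS -mulnA mul2n.
Qed.

(** An index doubles at each stage, so the factor [2 ^ n] in the test range keeps tested elements
    tested. The factor [n.+1] lets every element in: transported to stage [m], the index [j] is in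
    range once [j <= m]. *)
Lemma test_bound n m j : (j < n.+1 * 2 ^ n)%N -> (n <= m)%N ->
  (2 ^ (m - n) * j < m.+1 * 2 ^ m)%N.
Proof.
move=> jn nm; apply: (@leq_trans (2 ^ (m - n) * (n.+1 * 2 ^ n))).
  by rewrite ltn_pmul2l // expn_gt0.
by rewrite mulnCA -expnD subnK // leq_mul2r ltnS nm orbT.
Qed.

(** Passing from stage [i] to [i.+1] costs at most [2^-1 ^+ i]; the right-hand side is the exact
    geometric sum over the [k] stages from [m], a form that the induction preserves. *)
Lemma delta_transition_cauchy n m k j : (j < n.+1 * 2 ^ n)%N -> (n <= m)%N ->
  rn (delta (m + k)%N (tr n (m + k)%N (d n j)) - delta m (tr n m (d n j)))
    <= 2 * 2^-1 ^+ m - 2 * 2^-1 ^+ (m + k).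
Proof.
move=> jn nm; elim: k => [|k IH]; first by rewrite addn0 !subrr rnorm0.
have nmk : (n <= m + k)%N by rewrite (leq_trans nm) ?leq_addr.
rewrite addnS; set z := delta m _ in IH *.
have := delta_phi (test_bound jn nmk); rewrite -transition_dense_seq //.
rewrite transitionS // exprS; set u := delta (m + k)%N _ in IH *.
set v := delta (m + k).+1 _; have := ler_rnormB u v z.
by lra.
Qed.

Lemma delta_transition_near n m k j : (j < n.+1 * 2 ^ n)%N -> (n <= m)%N ->
  (m <= k)%N ->
  rn (delta k (tr n k (d n j)) - delta m (tr n m (d n j))) <= 2 * 2^-1 ^+ m.
Proof.
move=> jn nm mk; have := delta_transition_cauchy (k - m) jn nm.
by rewrite subnKC //; have := @exp_half_gt0 R k; lra.
Qed.

Lemma delta_transition_rcauchy n x : rcauchy (fun m => delta m (tr n m x)).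
Proof.
move=> e e0; have e8 : 0 < e / 8 by lra.
have [j xj] := d_dense x e8.
(* From stage [m0] on, the image of [d n j] is a test element. *)
pose m0 := maxn n j; have nm0 : (n <= m0)%N := leq_maxl n j.
have test : (2 ^ (m0 - n) * j < m0.+1 * 2 ^ m0)%N.
  rewrite mulnC; apply: (@leq_ltn_trans (m0 * 2 ^ m0)).
    by rewrite leq_mul ?leq_maxr // leq_exp2l // leq_subr.
  by rewrite ltn_pmul2r ?expn_gt0.
have [N NH] := exp_half_lt e8.
pose M := maxn N m0; exists M.
(* Replacing [x] by [d n j] costs [e / 8], and moving from stage [M] to [k] at most [2 * 2^-1 ^+ M],
   below [e / 4]. *)
have near k : (M <= k)%N ->
    rn (delta k (tr n k x) - delta M (tr n M (d n j))) < 3 / 8 * e.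
  move=> Mk; have m0M : (m0 <= M)%N := leq_maxr _ _.
  have m0k : (m0 <= k)%N := leq_trans m0M Mk.
  have := delta_transition_near test m0M Mk.
  rewrite -(transition_dense_seq _ nm0) !transition_trans //.
  have := NH M (leq_maxl _ _).
  have := starmorphism_norm (delta k) (tr n k (x - d n j)).
  have := starmorphism_norm (transition n phi k) (x - d n j).
  rewrite /= !raddfB.
  set u := delta k (transition n phi k x).
  set v := delta k (transition n phi k (d n j)).
  by have := ler_rnormB v u (delta M (transition n phi M (d n j))); lra.
move=> k l /near + /near; set z := delta M _ => kz lz.
by have := ler_rnormB z (delta k (tr n k x)) (delta l (tr n l x));
   rewrite (rnormC z); lra.
Qed.

Lemma approximate_intertwining : exists alpha : forall n, {starmorphism C n -> A},
  is_inductive_limit phi alpha.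
Proof.
pose f n m : {starmorphism C n -> A} := delta m \o transition n phi m.
have lim n := cid (@rcvg_starmorphism _ _ _ (f n) (@delta_transition_rcauchy n)).
pose alpha n := sval (lim n).
have alphaP n x : rcvg (fun m => delta m (tr n m x)) (alpha n x).
  exact: (svalP (lim n)).
exists alpha; apply: inductive_limit_criterion.
- move=> n x; apply: rcvg_unique (alphaP n x).
  apply: eq_rcvg (alphaP n.+1 (phi n x)); exists n.+1 => m nm.
  by rewrite transition_phi.
- move=> x e e0; have e4 : 0 < e / 4 by lra.
  have [j xj] := a_dense x e4; have [N NH] := exp_half_lt e4.
  (* The odd position [j.*2.+1] of stage [n.+1] holds an approximate preimage of [a j]; it lies in
     the test range, so [delta n.+1] and the limit [alpha n.+1] almost agree on it. *)
  pose n := maxn N j; have jn : (j <= n)%N := leq_maxr _ _.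
  pose y := d n.+1 j.*2.+1; exists n.+1, y.
  have test : (j.*2.+1 < n.+2 * 2 ^ n.+1)%N.
    rewrite expnS mulnCA mul2n -doubleS ltn_Sdouble.
    by rewrite (@leq_trans n.+2) // ?leq_pmulr ?expn_gt0 // ltnS ltnW.
  have : rn (alpha n.+1 y - delta n.+1 y) <= 2 * 2^-1 ^+ n.+1.
    apply: rcvg_rnorm_le (rcvgB (alphaP n.+1 y) (rcvg_cst _)) _ => r r0.
    exists n.+1 => k nk.
    have := delta_transition_near test (leqnn _) nk.
    by rewrite transition_id -/y; lra.
  have := delta_a jn; have := NH n (leq_maxl _ _); rewrite -/y exprS.
  have := ler_rnormB (a j) x (alpha n.+1 y).
  have := ler_rnormB (delta n.+1 y) (a j) (alpha n.+1 y).
  by rewrite (rnormC (alpha n.+1 y)); lra.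
- move=> n x e e0; have e4 : 0 < e / 4 by lra.
  have [j xj] := d_dense x e4.
  have [N NH] := eventually_and (alphaP n (d n j) _ e4) (exp_half_lt e4).
  (* The target stage is written [m.+1] so that [phi_norm] at stage [m] bounds the last step. The
     four quarters of [e] pay for two replacements of [x] by [d n j], for the limit defining
     [alpha], and for [phi_norm]. *)
  pose m0 := maxn N (maxn n j); exists m0.+1 => -[//|m]; rewrite ltnS !geq_max.
  move=> /andP[/NH[Nm1 Nm2] /andP[nm jm]].
  have test : (2 ^ (m - n) * j < m.+1 * 2 ^ m)%N.
    rewrite mulnC; apply: (@leq_ltn_trans (m * 2 ^ m)).
      by rewrite leq_mul // leq_exp2l // leq_subr.
    by rewrite ltn_pmul2r ?expn_gt0.
  have := phi_norm test; rewrite -transition_dense_seq // -transitionS //.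
  have := starmorphism_norm (transition n phi m.+1) (x - d n j).
  have := starmorphism_norm (alpha n) (x - d n j).
  rewrite !raddfB.
  set u := transition n phi m.+1 (d n j); set v := transition n phi m.+1 x.
  have := rnormD (v - u) u; rewrite subrK.
  have := rnormD (alpha n (d n j) - alpha n x) (alpha n x); rewrite subrK.
  rewrite (rnormC (alpha n x)).
  set w := delta m _ in Nm1 *.
  have := rnormD (w - alpha n (d n j)) (alpha n (d n j)); rewrite subrK.
  by rewrite (rnormC w); lra.
Qed.

End ApproximateIntertwining.

(* Two successive approximate lifts: from [A] to a building block [B n], then
   from [B n] to a member of the class. *)
Lemma approximate_factorization (R : realType) (Cls : cstarAlgType R -> Prop)
    (A C : cstarAlgType R) (gamma : {starmorphism C -> A})
    (c : nat -> C) p (a : nat -> A) q (e : R) :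
  AAC_algebra Cls A -> weakly_semiprojective C -> 0 < e ->
  exists (D : cstarAlgType R) (psi : {starmorphism C -> D})
    (delta : {starmorphism D -> A}), [/\ Cls D,
    forall i, (i < p)%N -> rn (delta (psi (c i)) - gamma (c i)) < e,
    forall i, (i < p)%N -> rn (psi (c i)) < rn (gamma (c i)) + e &
    forall j, (j < q)%N -> exists y, rn (a j - delta y) < e].
Proof.
move=> [B [phi [beta [BAC Blim]]]] Cwsp e0; have e2 : 0 < e / 2 by lra.
(* A single stage [N] serves both the lift of [gamma] and the approximation of the [a j]. *)
have [N /(_ N (leqnn _))[[psi psiE] bE]] := eventually_and
  (approximate_lift gamma c p Blim Cwsp e2)
  (eventually_ltn (p := q) (fun j _ => inductive_limit_dense Blim (a j) e2)).
have /choice[b {}bE] j : exists b, (j < q)%N -> rn (a j - beta N b) < e / 2.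
  by case: (ltnP j q) => [/bE[b bj]|]; [exists b|exists 0].
have [D [phi' [delta [DCls Dlim]]]] := BAC N.
(* Now [psi] itself is lifted along the system with limit [B N]; the errors [e / 2] add up, also in
   the norm bound. *)
have [M /(_ M (leqnn _))[[psi' psiE'] yE]] := eventually_and
  (approximate_lift psi c p Dlim Cwsp e2)
  (eventually_ltn (p := q) (fun j _ => inductive_limit_dense Dlim (b j) e2)).
pose gamma' : {starmorphism D M -> A} := beta N \o delta M.
exists (D M), psi', gamma'; split=> // [i|i|j].
- move=> ip; have [h1 _] := psiE i ip; have [h2 _] := psiE' i ip.
  have := starmorphism_norm (beta N) (delta M (psi' (c i)) - psi (c i)).
  rewrite raddfB /gamma' /=.
  have := ler_rnormB (beta N (psi (c i))) (beta N (delta M (psi' (c i))))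
    (gamma (c i)).
  by lra.
- by move=> ip; have [_ h1] := psiE i ip; have [_ h2] := psiE' i ip; lra.
- move=> jq; have [y yj] := yE j jq; exists y; have := bE j jq.
  have := starmorphism_norm (beta N) (b j - delta M y).
  rewrite raddfB /gamma' /=.
  by have := ler_rnormB (beta N (b j)) (a j) (beta N (delta M y)); lra.
Qed.

(** * Recursive construction of the approximate system *)

Section Stages.
Context {R : realType} (Cls : cstarAlgType R -> Prop).
Hypothesis HCls : forall C : cstarAlgType R, Cls C ->
  separable C /\ weakly_semiprojective C.
Context {A : cstarAlgType R}.

(** Bundling the algebra with its map to [A] and its dense sequence turns the dependent choices into
    a recursion over a single type. *)
Record stage := Stage {
  stage_algebra : cstarAlgType R;
  stage_class : Cls stage_algebra;
  stage_map : {starmorphism stage_algebra -> A};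
  stage_seq : nat -> stage_algebra;
  stage_dense : forall x (e : R), 0 < e -> exists i, rn (x - stage_seq i) < e
}.

Lemma first_stage : AAC_algebra Cls A -> inhabited stage.
Proof.
move=> [B [_ [beta [/(_ 0%N)[C [_ [gamma [CCls _]]]] _]]]].
have [d dd] := separable_seq (HCls (CCls 0%N)).1.
by split; exact: (@Stage (C 0%N) (CCls 0%N) (beta 0%N \o gamma 0%N) d dd).
Qed.

(* The even terms of the new sequence carry the old test elements along; the odd
   ones are dense and start with approximate preimages of the [a j]. *)
Definition next_stage_spec (a : nat -> A) k (S S' : stage)
    (phi : {starmorphism stage_algebra S -> stage_algebra S'}) :=
  [/\ forall j, stage_seq S' j.*2 = phi (stage_seq S j),
      forall i, (i < k.+1 * 2 ^ k)%N ->
        rn (stage_map S' (phi (stage_seq S i)) - stage_map S (stage_seq S i))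
          < 2^-1 ^+ k,
      forall i, (i < k.+1 * 2 ^ k)%N ->
        rn (phi (stage_seq S i)) < rn (stage_map S (stage_seq S i)) + 2^-1 ^+ k &
      forall j, (j <= k)%N ->
        rn (a j - stage_map S' (stage_seq S' j.*2.+1)) < 2^-1 ^+ k].

Lemma next_stage a k S : AAC_algebra Cls A ->
  exists S' phi, @next_stage_spec a k S S' phi.
Proof.
move=> AAC.
have [D [phi [delta [DCls h1 h2 yE]]]] := approximate_factorization
  (stage_map S) (stage_seq S) (k.+1 * 2 ^ k) a k.+1 AAC
  (HCls (stage_class S)).2 (exp_half_gt0 k).
have /choice[y {}yE] j : exists y, (j < k.+1)%N -> rn (a j - delta y) < 2^-1 ^+ k.
  by case: (ltnP j k.+1) => [/yE[y yj]|]; [exists y|exists 0].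
have [d dd] := separable_seq (HCls DCls).1.
(* The [k.+1] approximate preimages precede the dense sequence [d], which is shifted and so remains
   complete. *)
pose d' j := if (j <= k)%N then y j else d (j - k.+1)%N.
pose s i := if odd i then d' i./2 else phi (stage_seq S i./2).
have sd x (e : R) : 0 < e -> exists i, rn (x - s i) < e.
  move=> /(dd x)[i xi]; exists (i + k.+1)%N.*2.+1.
  rewrite /s /= odd_double /= uphalf_double /d' leqNgt.
  by rewrite ltn_addl //= addnK.
exists (Stage DCls delta sd), phi; split=> //= [j|j jk].
  by rewrite /s odd_double doubleK.
by rewrite /s /= odd_double /= uphalf_double /d' jk; exact: yE.
Qed.

End Stages.

Theorem theorem3p12 (R : realType) (Cls : cstarAlgType R -> Prop)
  (HCls : forall C : cstarAlgType R, Cls C ->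
     separable C /\ weakly_semiprojective C)
  (A : cstarAlgType R) :
  separable A -> AAC_algebra Cls A -> AC_algebra Cls A.
Proof.
move=> /separable_seq[a a_dense] AAC.
have [S0] := first_stage HCls AAC.
pose next k S := cid (next_stage HCls a k S AAC).
pose fix S k := if k is k'.+1 then sval (next k' (S k')) else S0.
(* [S k.+1] computes to the chosen successor of [S k], so the connecting morphisms have the right
   type without a cast. *)
pose phiP k := cid (svalP (next k (S k))).
pose phi k : {starmorphism stage_algebra (S k) -> stage_algebra (S k.+1)} :=
  sval (phiP k).
have phiE k : next_stage_spec a k (phi k) := svalP (phiP k).
have [] := @approximate_intertwining R _ phi A (fun k => stage_map (S k))
  (fun k => stage_seq (S k)) a.
- by move=> k; exact: stage_dense.
- exact: a_dense.
- by move=> k; case: (phiE k).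
- by move=> k; case: (phiE k).
- by move=> k; case: (phiE k).
- by move=> k; case: (phiE k).
move=> alpha lim; exists (fun k => stage_algebra (S k)), phi, alpha.
by split=> // k; exact: stage_class.
Qed.
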